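(* Let $K$ be an arbitrary field, let $m\ge 2$, let $\mathbf{V}$ be a variety of Lie algebras over $K$ satisfying a nontrivial identity of degree $m$, and let $\mathcal{C}(\mathbf{V},z)=\sum_{n=1}^\infty\frac{c_n(\mathbf{V})}{n!}z^n$ be its complexity function. Then the following coefficientwise bound holds: $$\mathcal{C}(\mathbf{V},z)\preceq \tilde r_m(z)=z\underbrace{\exp(z\exp(\cdots(z\exp(z\exp}_{m-2\text{ times }\exp}(z)))\cdots)),$$ where precisely $\tilde r_2(z)=z$ and $\tilde r_{k+1}(z)=z\exp(\tilde r_k(z))$ for $k\ge 2$.
   Context: For a variety $\mathbf{V}$ of Lie algebras over $K$, let $F(\mathbf{V},X)$ be its relatively free algebra on the countable set $X=\{x_i\mid i\in\mathbb{N}\}$. The codimension $c_n(\mathbf{V})$, $n\ge1$, is the dimension over $K$ of the subspace of $F(\mathbf{V},X)$ of multilinear polynomials of degree $n$ in $x_1,\dots,x_n$. A nontrivial identity of degree $m$ is a nonzero element of degree $m$ of the free Lie algebra $L(X)$. For power series with real coefficients, $\sum a_nz^n\preceq\sum b_nz^n$ means $a_n\le b_n$ for all $n\ge0$. *)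

(* Defs.v *)
From HB Require Import structures.
From mathcomp Require Import all_boot all_order all_algebra generic_quotient.
From mathcomp Require Import boolp classical_sets reals.
From mathcomp Require Import zify.

Set Implicit Arguments.
Unset Strict Implicit.
Unset Printing Implicit Defensive.

Import Order.TTheory GRing.Theory Num.Theory.
Local Open Scope classical_set_scope.
Local Open Scope quotient_scope.
Local Open Scope ring_scope.

(* The alternating law, rather than mere antisymmetry, is what is required in
   characteristic 2. *)
HB.mixin Record Lmodule_isLieAlg (K : fieldType) V of GRing.Lmodule K V := {
  lie_br : V -> V -> V;
  lie_brPl : forall (a : K) (x y z : V),
    lie_br (a *: x + y) z = a *: lie_br x z + lie_br y z;
  lie_brPr : forall (a : K) (x y z : V),
    lie_br z (a *: x + y) = a *: lie_br z x + lie_br z y;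
  lie_brxx : forall x : V, lie_br x x = 0;
  lie_jacobi : forall x y z : V,
    lie_br x (lie_br y z) + lie_br y (lie_br z x) + lie_br z (lie_br x y) = 0
}.

#[short(type="lieAlgType")]
HB.structure Definition LieAlg (K : fieldType) :=
  { V of GRing.Lmodule K V & Lmodule_isLieAlg K V }.

Definition is_lie_hom (K : fieldType) (A B : lieAlgType K) (h : A -> B) :=
  (forall (a : K) (x y : A), h (a *: x + y) = a *: h x + h y) /\
  (forall x y : A, h (lie_br x y) = lie_br (h x) (h y)).

Section LinearAlgebra.
Variables (K : fieldType) (E : lmodType K).

Definition span (G : set E) : set E :=
  [set v | exists s : seq (K * E),
     (forall p, p \in s -> G p.2) /\ v = \sum_(p <- s) p.1 *: p.2].

Definition is_basis (W : set E) (d : nat) (b : 'I_d -> E) : Prop :=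
  [/\ forall i, W (b i),
      forall a : 'I_d -> K, \sum_i a i *: b i = 0 -> forall i, a i = 0
    & forall v, W v -> exists a : 'I_d -> K, v = \sum_i a i *: b i].

Definition has_dim (W : set E) (d : nat) : Prop :=
  exists b : 'I_d -> E, is_basis W b.

Lemma span_sub (G : set E) v : G v -> span G v.
Proof.
move=> Gv; exists [:: (1, v)]; split; last by rewrite big_seq1 scale1r.
by move=> p; rewrite inE => /eqP ->.
Qed.

Lemma span0 (G : set E) : span G 0.
Proof. by exists [::]; split => //; rewrite big_nil. Qed.

Lemma spanP (G : set E) a u v : span G u -> span G v -> span G (a *: u + v).
Proof.
move=> [s [Gs ->]] [t [Gt ->]].
exists ([seq (a * p.1, p.2) | p <- s] ++ t); split.
  move=> p; rewrite mem_cat => /orP[/mapP[q qs ->]|/Gt //]; exact: (Gs q).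
rewrite big_cat big_map scaler_sumr; congr (_ + _).
by apply: eq_bigr => p _; rewrite scalerA.
Qed.

Lemma span_fin_has_dim (s : seq E) : exists d, has_dim (span [set` s]) d.
Proof.
suff [d [b [bs bi bg]]] : exists d, exists b : 'I_d -> E,
    [/\ forall i, b i \in s,
        forall a : 'I_d -> K, \sum_i a i *: b i = 0 -> forall i, a i = 0
      & forall v, v \in s -> exists a : 'I_d -> K, v = \sum_i a i *: b i].
  exists d, b; split => //; first by move=> i; apply: span_sub; exact: bs.
  move=> v [t [ts ->]]; elim: t ts => [|p t IH] ts.
    by exists (fun=> 0); rewrite big_nil big1 // => i _; rewrite scale0r.
  have [q qt|a e] := IH; first by apply: ts; rewrite inE qt orbT.
  have [|a' e'] := bg p.2; first by apply: (ts p); rewrite inE eqxx.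
  exists (fun i => p.1 * a' i + a i); rewrite big_cons e e' scaler_sumr.
  by rewrite -big_split; apply: eq_bigr => i _; rewrite scalerDl scalerA.
elim: s => [|x s [d [b [bs bi bg]]]].
  by exists 0%N, (fun=> 0); split => // [[]|a _ []] //.
have [[ax xE]|xN] := pselect (exists a : 'I_d -> K, x = \sum_i a i *: b i).
  exists d, b; split => //; first by move=> i; rewrite inE bs orbT.
  move=> v; rewrite inE => /orP[/eqP ->|/bg //]; by exists ax.
exists d.+1, (fun i => if unlift ord0 i is Some j then b j else x); split.
- by move=> i; case: unliftP => [j _|_]; rewrite inE ?eqxx // bs orbT.
- move=> a; rewrite big_ord_recl unlift_none.
  under eq_bigr do rewrite liftK.
  move=> e; have a0 : a ord0 = 0.
    apply/eqP; apply: contrapT => /negP a0; apply: xN.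
    exists (fun i => - (a ord0)^-1 * a (lift ord0 i)).
    under eq_bigr do rewrite -scalerA.
    rewrite -scaler_sumr; move/eqP: e; rewrite addrC addr_eq0 => /eqP ->.
    by rewrite scaleNr scalerN opprK scalerA mulVf // scale1r.
  move: e; rewrite a0 scale0r add0r => /bi a1 i.
  by case: (unliftP ord0 i) => [j|] ->.
- move=> v; rewrite inE => /orP[/eqP ->|/bg [a ->]].
    exists (fun i => (i == ord0)%:R); rewrite big_ord_recl unlift_none eqxx.
    by rewrite scale1r big1 ?addr0 // => i _; rewrite scale0r.
  exists (fun i => if unlift ord0 i is Some j then a j else 0).
  rewrite big_ord_recl unlift_none scale0r add0r.
  by apply: eq_bigr => i _; rewrite liftK.
Qed.

Lemma has_dim_unique (W : set E) d e : has_dim W d -> has_dim W e -> d = e.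
Proof.
suff H d' e' : has_dim W d' -> has_dim W e' -> (d' <= e')%N.
  by move=> hd he; apply/eqP; rewrite eqn_leq !H.
move=> [b [bW bi _]] [c [_ _ cg]].
have /choice [f fE] : forall i, exists a : 'I_e' -> K,
    b i = \sum_j a j *: c j by move=> i; apply: cg.
pose M : 'M[K]_(d', e') := \matrix_(i, j) f i j.
suff /eqP <- : row_free M by apply: rank_leq_col.
apply/row_freeP; apply/row_freeP; rewrite -kermx_eq0; apply/eqP/row_matrixP.
move=> k; rewrite row0; set u := row k _.
have uM : u *m M = 0 by apply/sub_kermxP; apply: row_sub.
suff bu : \sum_i u 0 i *: b i = 0.
  by apply/rowP => i; rewrite (bi (fun i => u 0 i) bu) mxE.
under eq_bigr => j _ do rewrite fE scaler_sumr.
rewrite exchange_big big1 // => j _.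
under eq_bigr => l _ do rewrite scalerA.
rewrite -scaler_suml; move/rowP/(_ j): uM; rewrite !mxE => uM.
by under eq_bigr => l _ do [have -> : f l j = M l j by rewrite mxE]; rewrite uM scale0r.
Qed.

End LinearAlgebra.

(* Nonassociative monomials in the letters x_i, i : nat. *)
Inductive monomial := Mvar of nat | Mbr of monomial & monomial.

Fixpoint tree_of_monomial (M : monomial) : GenTree.tree nat :=
  match M with
  | Mvar i => GenTree.Leaf i
  | Mbr M N => GenTree.Node 0 [:: tree_of_monomial M; tree_of_monomial N]
  end.

Fixpoint monomial_of_tree (t : GenTree.tree nat) : option monomial :=
  match t with
  | GenTree.Leaf i => Some (Mvar i)
  | GenTree.Node _ [:: t; u] =>
      if (monomial_of_tree t, monomial_of_tree u) is (Some M, Some N)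
      then Some (Mbr M N) else None
  | _ => None
  end.

Lemma tree_of_monomialK : pcancel tree_of_monomial monomial_of_tree.
Proof. by elim=> //= M -> N ->. Qed.

HB.instance Definition _ := Countable.copy monomial (pcan_type tree_of_monomialK).

Fixpoint letters (M : monomial) : seq nat :=
  match M with
  | Mvar i => [:: i]
  | Mbr M N => letters M ++ letters N
  end.

Definition mdegree (M : monomial) : nat := size (letters M).

Lemma finite_letters (s : seq nat) :
  exists l : seq monomial, forall M, letters M = s -> M \in l.
Proof.
suff /choice [l lP] : forall n, exists l : seq nat -> seq monomial,
    forall M, (mdegree M <= n)%N -> M \in l (letters M).
  by exists (l (size s) s) => M <-; apply: lP.
elim=> [|n [l lP]].
  exists (fun=> [::]); rewrite /mdegree; elim=> //= M IM N _.
  by rewrite size_cat leqn0 addn_eq0 -leqn0 => /andP[/IM].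
have ge1 M : (0 < mdegree M)%N.
  by rewrite /mdegree; elim: M => //= M IM N _; rewrite size_cat ltn_addr.
exists (fun s => [seq Mvar i | i <- s] ++
  flatten [seq [seq Mbr M N | M <- l (take k s), N <- l (drop k s)]
          | k <- iota 0 n.+2]).
case=> [i _|M N MN]; first by rewrite /= inE eqxx.
have M0 := ge1 M; have N0 := ge1 N.
have {}MN : (mdegree M + mdegree N <= n.+1)%N by rewrite -size_cat.
rewrite [letters _]/(letters M ++ letters N).
rewrite mem_cat; apply/orP; right; apply/flatten_mapP.
exists (mdegree M).
  rewrite mem_iota /= add0n ltnS (leq_trans _ MN) //; exact: leq_addr.
rewrite take_size_cat // drop_size_cat //; apply: allpairs_f; apply: lP.
  rewrite -ltnS; apply: leq_trans MN; by rewrite -addn1 leq_add2l.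
by rewrite -ltnS; apply: leq_trans MN; rewrite -add1n leq_add2r.
Qed.

Section Evaluation.
Variables (K : fieldType) (A : lieAlgType K) (x : nat -> A).

Fixpoint eval_mon (M : monomial) : A :=
  match M with
  | Mvar i => x i
  | Mbr M N => lie_br (eval_mon M) (eval_mon N)
  end.

(* A list of pairs (a, M) stands for the nonassociative polynomial
   \sum a M. *)
Definition eval_poly (s : seq (K * monomial)) : A :=
  \sum_(p <- s) p.1 *: eval_mon p.2.

End Evaluation.

(* Classes of Lie algebras are plain predicates: [set (lieAlgType K)] would put
   the universe of Lie algebras strictly below that of choiceType, and [relfree]
   would then not be a lieAlgType.

   The relatively free algebra F(V, X), X = {x_i | i : nat}: nonassociative
   polynomials in X, two of them being identified when they take the same
   values under all substitutions in all algebras of V.  Its universal property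
   is [relfree_lift] and [relfree_lift_unique] below; [relfree_in_variety]
   shows that it belongs to V when V is a variety. *)
Section RelativelyFree.
Variables (K : fieldType) (V : lieAlgType K -> Prop).
Implicit Types s t : seq (K * monomial).

Definition relfree_eq s t : bool :=
  `[< forall A : lieAlgType K, V A ->
      forall x : nat -> A, eval_poly x s = eval_poly x t >].

Lemma relfree_eq_refl : reflexive relfree_eq.
Proof. by move=> s; apply/asboolP. Qed.

Lemma relfree_eq_sym : symmetric relfree_eq.
Proof.
by move=> s t; apply/asboolP/asboolP => H A VA x; rewrite (H A VA x).
Qed.

Lemma relfree_eq_trans : transitive relfree_eq.
Proof.
move=> t s u /asboolP st /asboolP tu; apply/asboolP => A VA x.
by rewrite (st A VA x) (tu A VA x).
Qed.

Canonical relfree_equiv :=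
  EquivRel relfree_eq relfree_eq_refl relfree_eq_sym relfree_eq_trans.

Definition relfree := {eq_quot relfree_equiv}.
HB.instance Definition _ := Choice.on relfree.
HB.instance Definition _ := EqQuotient.on relfree.

Definition relfree_eval (A : lieAlgType K) (x : nat -> A) (u : relfree) : A :=
  eval_poly x (repr u).

Lemma relfree_evalE (A : lieAlgType K) (x : nat -> A) s :
  V A -> relfree_eval x (\pi_relfree s) = eval_poly x s.
Proof.
move=> VA; rewrite /relfree_eval.
have /eqmodP /asboolP : repr (\pi_relfree s) = s %[mod relfree] by rewrite reprK.
exact.
Qed.

Lemma relfreeP (u v : relfree) :
  (forall A : lieAlgType K, V A ->
     forall x : nat -> A, relfree_eval x u = relfree_eval x v) -> u = v.
Proof. by move=> H; rewrite -[u]reprK -[v]reprK; apply/eqmodP/asboolP. Qed.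

Definition poly_scale (a : K) s := [seq (a * p.1, p.2) | p <- s].
Definition poly_br s t :=
  [seq (p.1 * q.1, Mbr p.2 q.2) | p <- s, q <- t].

Lemma eval_cat (A : lieAlgType K) (x : nat -> A) s t :
  eval_poly x (s ++ t) = eval_poly x s + eval_poly x t.
Proof. by rewrite /eval_poly big_cat. Qed.

Lemma eval_scale (A : lieAlgType K) (x : nat -> A) a s :
  eval_poly x (poly_scale a s) = a *: eval_poly x s.
Proof.
rewrite /eval_poly big_map scaler_sumr.
by apply: eq_bigr => p _; rewrite scalerA.
Qed.

Lemma lie_br_suml (A : lieAlgType K) (I : Type) (r : seq I) (a : I -> K)
    (f : I -> A) z :
  lie_br (\sum_(i <- r) a i *: f i) z = \sum_(i <- r) a i *: lie_br (f i) z.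
Proof.
elim: r => [|i r IH]; last by rewrite !big_cons lie_brPl IH.
rewrite !big_nil; have := lie_brPl (1 : K) 0 0 z.
by rewrite !scale1r add0r => /(congr1 (+%R^~ (- lie_br 0 z))); rewrite addrK subrr.
Qed.

Lemma lie_br_sumr (A : lieAlgType K) (I : Type) (r : seq I) (a : I -> K)
    (f : I -> A) z :
  lie_br z (\sum_(i <- r) a i *: f i) = \sum_(i <- r) a i *: lie_br z (f i).
Proof.
elim: r => [|i r IH]; last by rewrite !big_cons lie_brPr IH.
rewrite !big_nil; have := lie_brPr (1 : K) 0 0 z.
by rewrite !scale1r add0r => /(congr1 (+%R^~ (- lie_br z 0))); rewrite addrK subrr.
Qed.

Lemma eval_br (A : lieAlgType K) (x : nat -> A) s t :
  eval_poly x (poly_br s t) = lie_br (eval_poly x s) (eval_poly x t).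
Proof.
rewrite /eval_poly big_allpairs_dep lie_br_suml; apply: eq_bigr => p _ /=.
rewrite lie_br_sumr scaler_sumr; apply: eq_bigr => q _ /=.
by rewrite scalerA.
Qed.

Definition relfree_zero : relfree := \pi_relfree [::].
Definition relfree_add (u v : relfree) : relfree := \pi_relfree (repr u ++ repr v).
Definition relfree_scale (a : K) (u : relfree) : relfree :=
  \pi_relfree (poly_scale a (repr u)).
Definition relfree_opp (u : relfree) : relfree := relfree_scale (-1) u.
Definition relfree_br (u v : relfree) : relfree := \pi_relfree (poly_br (repr u) (repr v)).

Lemma relfree_eval0 (A : lieAlgType K) (x : nat -> A) :
  V A -> relfree_eval x relfree_zero = 0.
Proof. by move=> VA; rewrite relfree_evalE // /eval_poly big_nil. Qed.

Lemma relfree_evalD (A : lieAlgType K) (x : nat -> A) u v : V A ->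
  relfree_eval x (relfree_add u v) = relfree_eval x u + relfree_eval x v.
Proof. by move=> VA; rewrite relfree_evalE // eval_cat. Qed.

Lemma relfree_evalZ (A : lieAlgType K) (x : nat -> A) a u : V A ->
  relfree_eval x (relfree_scale a u) = a *: relfree_eval x u.
Proof. by move=> VA; rewrite relfree_evalE // eval_scale. Qed.

Lemma relfree_evalBr (A : lieAlgType K) (x : nat -> A) u v : V A ->
  relfree_eval x (relfree_br u v) = lie_br (relfree_eval x u) (relfree_eval x v).
Proof. by move=> VA; rewrite relfree_evalE // eval_br. Qed.

Let evalE := (relfree_eval0, relfree_evalD, relfree_evalZ, relfree_evalBr).

Lemma relfree_addA : associative relfree_add.
Proof. by move=> u v w; apply: relfreeP => A VA x; rewrite !evalE // addrA. Qed.
Lemma relfree_addC : commutative relfree_add.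
Proof. by move=> u v; apply: relfreeP => A VA x; rewrite !evalE // addrC. Qed.
Lemma relfree_add0 : left_id relfree_zero relfree_add.
Proof. by move=> u; apply: relfreeP => A VA x; rewrite !evalE // add0r. Qed.
Lemma relfree_addN : left_inverse relfree_zero relfree_opp relfree_add.
Proof.
by move=> u; apply: relfreeP => A VA x; rewrite !evalE // scaleN1r addNr.
Qed.

HB.instance Definition _ := GRing.isZmodule.Build relfree
  relfree_addA relfree_addC relfree_add0 relfree_addN.

Lemma relfree_scaleA a b u :
  relfree_scale a (relfree_scale b u) = relfree_scale (a * b) u.
Proof. by apply: relfreeP => A VA x; rewrite !evalE // scalerA. Qed.
Lemma relfree_scale1 : left_id 1 relfree_scale.
Proof. by move=> u; apply: relfreeP => A VA x; rewrite !evalE // scale1r. Qed.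
Lemma relfree_scaleDr : right_distributive relfree_scale +%R.
Proof.
by move=> a u v; apply: relfreeP => A VA x; rewrite !evalE // scalerDr.
Qed.
Lemma relfree_scaleDl u : {morph relfree_scale^~ u : a b / a + b}.
Proof. by move=> a b; apply: relfreeP => A VA x; rewrite !evalE // scalerDl. Qed.

HB.instance Definition _ := GRing.Zmodule_isLmodule.Build K relfree
  relfree_scaleA relfree_scale1 relfree_scaleDr relfree_scaleDl.

Lemma relfree_brPl (a : K) (u v w : relfree) :
  relfree_br (a *: u + v) w = a *: relfree_br u w + relfree_br v w.
Proof. by apply: relfreeP => A VA x; rewrite !evalE // lie_brPl. Qed.
Lemma relfree_brPr (a : K) (u v w : relfree) :
  relfree_br w (a *: u + v) = a *: relfree_br w u + relfree_br w v.
Proof. by apply: relfreeP => A VA x; rewrite !evalE // lie_brPr. Qed.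
Lemma relfree_brxx (u : relfree) : relfree_br u u = 0.
Proof. by apply: relfreeP => A VA x; rewrite !evalE // lie_brxx. Qed.
Lemma relfree_jacobi (u v w : relfree) :
  relfree_br u (relfree_br v w) + relfree_br v (relfree_br w u)
    + relfree_br w (relfree_br u v) = 0.
Proof. by apply: relfreeP => A VA x; rewrite !evalE // lie_jacobi. Qed.

HB.instance Definition _ := Lmodule_isLieAlg.Build K relfree
  relfree_brPl relfree_brPr relfree_brxx relfree_jacobi.

Definition relfree_gen (i : nat) : relfree := \pi_relfree [:: (1, Mvar i)].

Lemma relfree_eval_hom (A : lieAlgType K) (x : nat -> A) :
  V A -> is_lie_hom (relfree_eval x).
Proof. by move=> VA; split=> *; rewrite !evalE. Qed.

Lemma relfree_lift (A : lieAlgType K) (x : nat -> A) : V A ->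
  exists2 h : relfree -> A, is_lie_hom h & forall i, h (relfree_gen i) = x i.
Proof.
move=> VA; exists (relfree_eval x); first exact: relfree_eval_hom.
by move=> i; rewrite relfree_evalE // /eval_poly big_seq1 scale1r.
Qed.

Lemma relfree_piE s : \pi_relfree s = eval_poly relfree_gen s.
Proof.
have genE M : \pi_relfree [:: (1, M)] = eval_mon relfree_gen M.
  elim: M => //= M <- N <-; apply: relfreeP => A VA x.
  rewrite relfree_evalBr // !relfree_evalE // -eval_br /poly_br /=.
  by rewrite mulr1.
elim: s => [|p s IH]; first by rewrite /eval_poly big_nil.
rewrite /eval_poly big_cons -/(eval_poly _ _) -IH -genE.
apply: relfreeP => A VA x.
rewrite relfree_evalD // relfree_evalZ // !relfree_evalE //.
by rewrite /eval_poly big_cons big_seq1 /= scale1r.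
Qed.

Lemma lie_hom_eval (A B : lieAlgType K) (h : A -> B) (x : nat -> A) s :
  is_lie_hom h -> h (eval_poly x s) = eval_poly (h \o x) s.
Proof.
move=> [hl hb]; rewrite /eval_poly.
have h0 : h 0 = 0.
  have := hl (-1) 0 0; rewrite scaler0 add0r => {1}->.
  by rewrite scaleN1r addNr.
have hM M : h (eval_mon x M) = eval_mon (h \o x) M.
  by elim: M => //= M IM N IN; rewrite hb IM IN.
elim: s => [|p s IH]; first by rewrite !big_nil.
by rewrite !big_cons hl IH hM.
Qed.

Lemma relfree_lift_unique (A : lieAlgType K) (h h' : relfree -> A) :
  is_lie_hom h -> is_lie_hom h' ->
  (forall i, h (relfree_gen i) = h' (relfree_gen i)) -> h =1 h'.
Proof.
move=> hh hh' E u; rewrite -[u]reprK relfree_piE !lie_hom_eval //.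
by congr eval_poly; apply/funext.
Qed.

End RelativelyFree.

(* L(X) is the relatively free algebra of the variety of all Lie algebras. *)
Definition free_lie (K : fieldType) : lieAlgType K := relfree (fun=> True).

Definition is_identity (K : fieldType) (A : lieAlgType K) (f : free_lie K) :=
  forall h : free_lie K -> A, is_lie_hom h -> h f = 0.

Definition satisfies (K : fieldType) (V : lieAlgType K -> Prop) (f : free_lie K) :=
  forall A : lieAlgType K, V A -> is_identity A f.

Definition is_variety (K : fieldType) (V : lieAlgType K -> Prop) :=
  exists S : set (free_lie K),
    forall A : lieAlgType K, V A <-> forall f, S f -> is_identity A f.

Lemma relfree_in_variety (K : fieldType) (V : lieAlgType K -> Prop) :
  is_variety V -> V (relfree V).
Proof.
move=> [S VS]; apply/VS => f Sf h hh; apply: relfreeP => A VA x.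
have [hx hx'] := relfree_eval_hom x VA.
transitivity ((relfree_eval x \o h) f); first by [].
have -> : relfree_eval x (0 : relfree V) = 0 by apply: relfree_eval0.
apply: (iffLR (VS A) VA f Sf); split => [a u v|u v] /=.
  by rewrite hh.1 hx.
by rewrite hh.2 hx'.
Qed.

Definition homogeneous (K : fieldType) (d : nat) : set (free_lie K) :=
  span [set u | exists2 M, mdegree M = d & u = eval_mon (@relfree_gen K (fun=> True)) M].

(* f = f_0 + ... + f_m with f_i homogeneous of degree i and f_m != 0; f is
   not required to be homogeneous. *)
Definition has_degree (K : fieldType) (m : nat) (f : free_lie K) : Prop :=
  exists g : nat -> free_lie K,
    [/\ forall i, homogeneous i (g i), g m != 0 & f = \sum_(i < m.+1) g i].

Section Codimension.
Variables (K : fieldType) (V : lieAlgType K -> Prop).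

Definition multilinear (n : nat) : set (relfree V) :=
  span [set u | exists2 M, perm_eq (letters M) (iota 1 n) &
                           u = eval_mon (@relfree_gen K V) M].

Lemma multilinear_has_dim (n : nat) : exists d, has_dim (multilinear n) d.
Proof.
have /choice [l lP] := finite_letters.
pose s := [seq M <- flatten [seq l t | t <- permutations (iota 1 n)]
          | perm_eq (letters M) (iota 1 n)].
have [d hd] := span_fin_has_dim [seq eval_mon (@relfree_gen K V) M | M <- s].
exists d; rewrite /multilinear; congr (has_dim (span _) d): hd.
apply/seteqP; split => u /=.
  by move=> /mapP[M]; rewrite mem_filter => /andP[pM _] ->; exists M.
move=> [M pM ->]; apply: map_f; rewrite mem_filter pM /=.
apply/flatten_mapP; exists (letters M); first by rewrite mem_permutations.
exact: lP.
Qed.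

Definition codim (n : nat) : nat := projT1 (cid (multilinear_has_dim n)).

Lemma codimP (n : nat) : has_dim (multilinear n) (codim n).
Proof. exact: (projT2 (cid (multilinear_has_dim n))). Qed.

End Codimension.

(* Formal power series, given by their coefficients. *)
Section PowerSeries.
Variable R : realType.

Definition fps := nat -> R.
Implicit Types f g : fps.

Definition fps_mul f g : fps := fun n => \sum_(i < n.+1) f i * g (n - i)%N.
Definition fps_one : fps := fun n => (n == 0%N)%:R.
Definition fps_X : fps := fun n => (n == 1%N)%:R.
Definition fps_pow f (k : nat) : fps := iter k (fps_mul f) fps_one.

(* exp f = \sum_k f ^ k / k! for f with zero constant term; by
   [fps_pow_small] the terms with k > n do not contribute to the coefficient of
   degree n. *)
Definition fps_exp f : fps :=
  fun n => \sum_(k < n.+1) fps_pow f k n / (k`!)%:R.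

Lemma fps_pow_small f k n : f 0%N = 0 -> (n < k)%N -> fps_pow f k n = 0.
Proof.
move=> f0; elim: k n => // k IH n nk.
rewrite [LHS]/(fps_mul f (fps_pow f k) n) /fps_mul.
rewrite big1 // => -[[|i] lin] _ /=; first by rewrite f0 mul0r.
by rewrite IH ?mulr0 //; lia.
Qed.

Definition coef_le f g : Prop := forall n, f n <= g n.

Definition complexity (K : fieldType) (V : lieAlgType K -> Prop) : fps :=
  fun n => if n is 0 then 0 else (codim V n)%:R / (n`!)%:R.

(* Meaningful for m >= 2. *)
Definition r_tilde (m : nat) : fps :=
  iter (m - 2) (fun f => fps_mul fps_X (fps_exp f)) fps_X.

Lemma r_tilde2 : r_tilde 2 = fps_X. Proof. by []. Qed.

Lemma r_tildeS k : (2 <= k)%N ->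
  r_tilde k.+1 = fps_mul fps_X (fps_exp (r_tilde k)).
Proof. by move=> k2; rewrite /r_tilde subSn. Qed.

Lemma r_tilde_coef0 m : r_tilde m 0%N = 0.
Proof.
rewrite /r_tilde; case: (m - 2)%N => [|k] //=.
by rewrite /fps_mul big_ord1 /fps_X mul0r.
Qed.

End PowerSeries.

(* Main.v *)
Require Import Defs.
From HB Require Import structures.
From Stdlib Require Cantor.
From mathcomp Require Import all_boot all_order all_algebra.
From mathcomp Require Import boolp classical_sets functions reals.
From mathcomp Require Import zify ring.
Import Order.TTheory GRing.Theory Num.Theory.
Local Open Scope ring_scope.
Set Implicit Arguments.
Unset Strict Implicit.
Unset Printing Implicit Defensive.

(** Write [[x_1, [x_2, ..., [x_n, z]]]] as the word x_1 ... x_n acting on z.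

    An identity of degree m becomes multilinear. Let f_m be the leading
    component of the identity f. If every associative coefficient of f_m
    were zero, f_m would take central values in all Lie algebras. A Lie
    polynomial with that property is zero ([central_values_vanish]). In
    characteristic 0 linearization could instead be undone by identifying
    variables again; over an arbitrary field this consequence of Witt's theorem
    is what keeps the linearized identity nontrivial. So some word w0 of length
    m has a nonzero coefficient in f_m. Substituting for each letter of w0 the
    sum of one new variable for each of its places in w0, and keeping by
    inclusion-exclusion the part in which all m new variables occur, gives a
    multilinear identity of V whose right-normed form has the coefficient of w0
    at the identity permutation ([multilinear_part]). Hence with k = m - 1
    [sum_s beta_s ad(a_s(0)) ... ad(a_s(k-1)) = 0] on the relatively free
    algebra, with beta_id <> 0 ([variety_ad_identity]).

    Multilinear elements in x_1, ..., x_n are combinations of words in 1, ...,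
    n-1 acting on x_n. Order words lexicographically. A word whose first letter
    is its maximum is the leading word of ad of a Lie element, the left-normed
    bracket of its letters. So if a word contains k consecutive blocks, each
    starting with a letter that exceeds all later letters of these blocks, then
    the identity, applied to the left-normed brackets of the blocks, rewrites
    the word through smaller ones: permuting the blocks makes the word smaller,
    since their heads decrease ([ad_word_reducible]). Therefore words without
    such blocks span ([ad_word_irreducible_span]).

    Make each letter of a word a child of the nearest larger letter on its
    left, or a root if there is none. This identifies words with decreasing
    labelled forests, and a word contains k blocks as above exactly when its
    forest has a path of k vertices. The spanning words are thus the decreasing
    forests with at most m - 2 levels. Splitting a word at its maximum M as u M
    v, where v has at most d levels if the word has at most d + 1, gives the
    recursion D_{d+1}' = D_{d+1} D_d for the exponential generating functions
    of forests with at most d levels. The series F_0 = 1, F_{d+1} = exp (z F_d)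
    satisfies F_{d+1}' = (z F_d)' F_{d+1}, which coefficientwise dominates
    F_{d+1} F_d, so D_d is bounded by F_d ([irreducible_words]); and z F_{m-2}
    is the series of the theorem. *)

(** * Lie monomials and their associative expansions *)

Section Bracket.
Variables (K : fieldType) (A : lieAlgType K).
Implicit Types (x y z : A) (a : K).

Lemma lie_br0l z : lie_br 0 z = 0 :> A.
Proof.
by have := lie_brPl (-1 : K) 0 0 z; rewrite scaler0 addr0 scaleN1r addNr.
Qed.

Lemma lie_br0r z : lie_br z 0 = 0 :> A.
Proof.
by have := lie_brPr (-1 : K) 0 0 z; rewrite scaler0 addr0 scaleN1r addNr.
Qed.

Lemma lie_brDl x y z : lie_br (x + y) z = lie_br x z + lie_br y z.
Proof. by rewrite -[x in LHS]scale1r lie_brPl scale1r. Qed.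

Lemma lie_brDr x y z : lie_br z (x + y) = lie_br z x + lie_br z y.
Proof. by rewrite -[x in LHS]scale1r lie_brPr scale1r. Qed.

Lemma lie_brZl a x z : lie_br (a *: x) z = a *: lie_br x z.
Proof. by rewrite -[a *: x]addr0 lie_brPl lie_br0l addr0. Qed.

Lemma lie_brZr a x z : lie_br z (a *: x) = a *: lie_br z x.
Proof. by rewrite -[a *: x]addr0 lie_brPr lie_br0r addr0. Qed.

Lemma lie_brNr x z : lie_br z (- x) = - lie_br z x.
Proof. by rewrite -scaleN1r lie_brZr scaleN1r. Qed.

Lemma lie_brBr x y z : lie_br z (x - y) = lie_br z x - lie_br z y.
Proof. by rewrite lie_brDr lie_brNr. Qed.

Lemma lie_brC x y : lie_br x y = - lie_br y x.
Proof.
apply/eqP; rewrite -addr_eq0; apply/eqP.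
have := lie_brxx (x + y).
by rewrite lie_brDl !lie_brDr !lie_brxx add0r addr0.
Qed.

Lemma lie_br_ad x y z :
  lie_br (lie_br x y) z = lie_br x (lie_br y z) - lie_br y (lie_br x z).
Proof.
have := lie_jacobi x y z; rewrite (lie_brC z x) lie_brNr (lie_brC z).
by move/eqP; rewrite subr_eq0 => /eqP <-.
Qed.

End Bracket.

Section AssociativeExpansion.
Implicit Types (M N : monomial) (u v w : seq nat).

(** The value at the associative expansion of M, a signed sum of words, of the
    linear extension of phi.  Since the coefficients are signs, phi may take its
    values in any abelian group, and no associative algebra has to be built. *)
Fixpoint assoc (U : zmodType) M (phi : seq nat -> U) : U :=
  match M with
  | Mvar i => phi [:: i]
  | Mbr M N => assoc M (fun u => assoc N (fun v => phi (u ++ v) - phi (v ++ u)))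
  end.

Lemma assoc_eq (U : zmodType) M (phi psi : seq nat -> U) :
  (forall w, perm_eq w (letters M) -> phi w = psi w) ->
  assoc M phi = assoc M psi.
Proof.
elim: M phi psi => [i|M IM N IN] phi psi E /=; first exact: E.
apply: IM => u uM; apply: IN => v vN; congr (_ - _); apply: E.
  exact: perm_cat.
by rewrite perm_catC perm_cat.
Qed.

Lemma assoc_morph (U U' : zmodType) (f : U -> U') M phi :
  (forall x y, f (x - y) = f x - f y) ->
  f (assoc M phi) = assoc M (f \o phi).
Proof.
move=> fB; elim: M phi => [i|M IM N IN] phi //=.
rewrite IM; apply: assoc_eq => u _; rewrite /= IN.
by apply: assoc_eq => v _; rewrite /= fB.
Qed.

Lemma assocB (U : zmodType) M (phi psi : seq nat -> U) :
  assoc M (fun w => phi w - psi w) = assoc M phi - assoc M psi.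
Proof.
elim: M phi psi => [i|M IM N IN] phi psi //=.
rewrite -IM; apply: assoc_eq => u _; rewrite -IN.
by apply: assoc_eq => v _; rewrite !opprD !opprK addrACA.
Qed.

Lemma assoc0 (U : zmodType) M : assoc M (fun=> 0) = 0 :> U.
Proof.
by have := assocB M (fun=> 0 : U) (fun=> 0); rewrite !subrr => ->.
Qed.

Lemma assocD (U : zmodType) M (phi psi : seq nat -> U) :
  assoc M (fun w => phi w + psi w) = assoc M phi + assoc M psi.
Proof.
transitivity (assoc M (fun w => phi w - (0 - psi w))).
  by apply: assoc_eq => w _; rewrite sub0r opprK.
by rewrite !assocB assoc0 sub0r opprK.
Qed.

Lemma assoc_sum (U : zmodType) I (r : seq I) M (F : I -> seq nat -> U) :
  assoc M (fun w => \sum_(i <- r) F i w) = \sum_(i <- r) assoc M (F i).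
Proof.
elim: r => [|i r IH].
  by rewrite big_nil -[RHS](assoc0 U M); apply: assoc_eq => w _; rewrite big_nil.
rewrite big_cons -IH -assocD.
by apply: assoc_eq => w _; rewrite big_cons.
Qed.

Lemma assoc_exchange (U : zmodType) M N (psi : seq nat -> seq nat -> U) :
  assoc M (fun u => assoc N (psi u)) =
  assoc N (fun v => assoc M (fun u => psi u v)).
Proof.
elim: M psi => [i|M1 IM1 M2 IM2] psi //=.
rewrite -IM1; apply: assoc_eq => u _; rewrite -IM2.
by apply: assoc_eq => v _; rewrite -assocB.
Qed.

Lemma assoc_delta (K : fieldType) (U : lmodType K) M w (x : U) :
  assoc M (fun v => (v == w)%:R *: x) = assoc M (fun v => (v == w)%:R : K) *: x.
Proof.
symmetry; apply: (@assoc_morph _ _ (fun a : K => a *: x)) => a b.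
exact: scalerBl.
Qed.

Lemma assoc_span (K : fieldType) (U : lmodType K) (G : set U) M phi :
  (forall w, perm_eq w (letters M) -> Defs.span G (phi w)) ->
  Defs.span G (assoc M phi).
Proof.
elim: M phi => [i|M IM N IN] phi H /=; first exact: H.
apply: IM => u uM; apply: IN => v vN.
rewrite addrC -scaleN1r; apply: spanP; apply: H; last exact: perm_cat.
by rewrite perm_catC perm_cat.
Qed.

End AssociativeExpansion.

Section RightNormed.
Variables (K : fieldType) (A : lieAlgType K) (x : nat -> A).
Implicit Types (M N : monomial) (u v w : seq nat).

Definition ad_word w (z : A) : A := foldr (fun i => lie_br (x i)) z w.

Lemma ad_word_cat u v z : ad_word (u ++ v) z = ad_word u (ad_word v z).
Proof. exact: foldr_cat. Qed.

Lemma ad_wordB w y z : ad_word w (y - z) = ad_word w y - ad_word w z.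
Proof. by elim: w => //= i w ->; rewrite lie_brBr. Qed.

Lemma ad_word0 w : ad_word w 0 = 0.
Proof. by elim: w => //= i w ->; rewrite lie_br0r. Qed.

Lemma ad_wordP w a y z : ad_word w (a *: y + z) = a *: ad_word w y + ad_word w z.
Proof. by elim: w => //= i w ->; rewrite lie_brPr. Qed.

Lemma ad_word_assoc w M (phi : seq nat -> A) :
  ad_word w (assoc M phi) = assoc M (fun u => ad_word w (phi u)).
Proof. exact: (assoc_morph _ _ (ad_wordB w)). Qed.

(** ad is a Lie homomorphism into the associative algebra of endomorphisms. *)
Lemma lie_br_assoc M z : lie_br (eval_mon x M) z = assoc M (ad_word^~ z).
Proof.
elim: M z => //= M IM N IN z; rewrite lie_br_ad (IN z) (IM z) IM IN.
under [X in _ - X]assoc_eq do rewrite ad_word_assoc.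
rewrite assoc_exchange -assocB; apply: assoc_eq => u _.
rewrite ad_word_assoc -assocB; apply: assoc_eq => v _.
by rewrite !ad_word_cat.
Qed.

(** The right-normed bracket of a word that ends with r; words with another last
    letter are sent to 0, so that this is one linear functional on all words. *)
Fixpoint right_normed (r : nat) w : A :=
  match w with
  | [::] => 0
  | i :: w' => if w' is [::] then (if i == r then x i else 0)
               else lie_br (x i) (right_normed r w')
  end.

Lemma right_normed_cat r u v : v != [::] ->
  right_normed r (u ++ v) = ad_word u (right_normed r v).
Proof. by move=> v0; elim: u => //= i [|j u] <- //; case: v v0. Qed.

Lemma right_normed_rcons r w i :
  right_normed r (rcons w i) = if i == r then ad_word w (x i) else 0.
Proof. by rewrite -cats1 right_normed_cat //=; case: ifP; rewrite ?ad_word0. Qed.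

Lemma letters_neq0 M w : perm_eq w (letters M) -> w != [::].
Proof.
elim: M w => [i|M IM N _] w /perm_size; first by case: w.
rewrite /= size_cat; have := IM _ (perm_refl _).
by case: (letters M) => //; case: w.
Qed.

Lemma assoc_right_normed_br r M N :
  assoc (Mbr M N) (right_normed r) =
  lie_br (eval_mon x M) (assoc N (right_normed r))
    - lie_br (eval_mon x N) (assoc M (right_normed r)).
Proof.
rewrite !lie_br_assoc /=.
under [X in _ - X]assoc_eq do rewrite ad_word_assoc.
rewrite [X in _ - X]assoc_exchange -assocB; apply: assoc_eq => u uM.
rewrite ad_word_assoc -assocB; apply: assoc_eq => v vN.
by rewrite !right_normed_cat ?(letters_neq0 uM) ?(letters_neq0 vN).
Qed.

Lemma assoc_right_normed0 r M : r \notin letters M -> assoc M (right_normed r) = 0.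
Proof.
elim: M => [i|M IM N IN].
  by rewrite inE eq_sym /= => /negbTE ->.
rewrite assoc_right_normed_br mem_cat negb_or => /andP[/IM -> /IN ->].
by rewrite !lie_br0r subr0.
Qed.

(** In [[M, N] = M N - N M] exactly one of the two products ends with the factor that
    contains r, so the words that end with r determine the value of M. *)
Lemma eval_mon_right_normed r M :
  count_mem r (letters M) = 1%N -> eval_mon x M = assoc M (right_normed r).
Proof.
elim: M => [i|M IM N IN]; first by rewrite /= addn0; case: (i == r).
rewrite assoc_right_normed_br [letters _]/= count_cat.
case cM: (count_mem r (letters M)) => [|[|c]] //.
  rewrite add0n => /IN <-; rewrite assoc_right_normed0 ?lie_br0r ?subr0 //.
  exact/count_memPn.
rewrite add1n => -[/count_memPn rN].
by rewrite (assoc_right_normed0 rN) lie_br0r sub0r -IM // -lie_brC.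
Qed.

End RightNormed.

(** * A Lie bracket on divided power series *)

Section PowerBracket.
Variables (K : fieldType) (A : lieAlgType K).
Implicit Types (f g h : nat -> A) (a b : K) (n : nat).

Definition shift f : nat -> A := fun n => f n.+1.

(** A sequence f stands for the divided power series with coefficients f n in A,
    so that [shift] is the derivation d/dt.  The bracket is computed
    from its constant term and the Leibniz rule; unfolding the recursion would
    give binomial convolution.  With ordinary power series (d/dt)^p would be 0 in
    characteristic p, and the constant terms of the derivatives of a series
    could not be prescribed. *)
Fixpoint dp_br f g n : A :=
  match n with
  | 0 => lie_br (f 0%N) (g 0%N)
  | n.+1 => dp_br (shift f) g n + dp_br f (shift g) n
  end.

Lemma dp_brPl a f g h n :
  dp_br (a *: f + g) h n = a *: dp_br f h n + dp_br g h n.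
Proof.
elim: n f g h => [|n IH] f g h /=; first exact: lie_brPl.
have -> : shift (a *: f + g) = a *: shift f + shift g by [].
by rewrite !IH scalerDr addrACA.
Qed.

Lemma dp_brC f g n : dp_br f g n = - dp_br g f n.
Proof.
elim: n f g => [|n IH] f g /=; first exact: lie_brC.
by rewrite opprD addrC -!IH.
Qed.

Lemma dp_brPr a f g h n :
  dp_br h (a *: f + g) n = a *: dp_br h f n + dp_br h g n.
Proof. by rewrite dp_brC dp_brPl opprD -scalerN -!dp_brC. Qed.

Lemma dp_brxx f n : dp_br f f n = 0.
Proof.
by case: n => [|n] /=; rewrite ?lie_brxx // dp_brC addNr.
Qed.

Lemma dp_brDr f g h n : dp_br h (f + g) n = dp_br h f n + dp_br h g n.
Proof. by have := dp_brPr 1 f g h n; rewrite !scale1r. Qed.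

Lemma dp_br0 h n : dp_br h 0 n = 0.
Proof. by apply: (addIr (dp_br h 0 n)); rewrite -dp_brDr !add0r. Qed.

Lemma dp_brZr a g h n : dp_br h (a *: g) n = a *: dp_br h g n.
Proof. by rewrite -[a *: g]addr0 dp_brPr dp_br0 addr0. Qed.

Lemma dp_brBr f g h n : dp_br h (f - g) n = dp_br h f n - dp_br h g n.
Proof. by rewrite -scaleN1r dp_brDr dp_brZr scaleN1r. Qed.

Lemma shift_dp_br f g : shift (dp_br f g) = dp_br (shift f) g + dp_br f (shift g).
Proof. by []. Qed.

Lemma dp_br_jacobi f g h n :
  dp_br f (dp_br g h) n + dp_br g (dp_br h f) n + dp_br h (dp_br f g) n = 0.
Proof.
elim: n f g h => [|n IH] f g h /=; first exact: lie_jacobi.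
rewrite !shift_dp_br !dp_brDr.
(* One Jacobi identity for each choice of the shifted sequence. *)
rewrite !addrA (ACl ((1*6*8)*(2*4*9)*(3*5*7))) /=.
by rewrite !IH !addr0.
Qed.

End PowerBracket.

(** Divided power series over A, extended by the derivation d/dt: the pair (f, a)
    stands for f + a d/dt. *)
Definition power_ext (K : fieldType) (A : lieAlgType K) : Type :=
  ((nat -> A) * K^o)%type.

Section PowerExtension.
Variables (K : fieldType) (A : lieAlgType K).
Local Notation E := (power_ext A).

HB.instance Definition _ := GRing.Lmodule.copy E ((nat -> A) * K^o)%type.

Definition ext_br (u v : E) : E :=
  (dp_br u.1 v.1 + ((u.2 : K) *: shift v.1 - (v.2 : K) *: shift u.1), 0).

Lemma ext_brPl (a : K) (u v w : E) :
  ext_br (a *: u + v) w = a *: ext_br u w + ext_br v w.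
Proof.
rewrite /ext_br; apply: injective_projections => /=; last first.
  by rewrite scaler0 addr0.
apply/funext => n.
rewrite !fctE dp_brPl !scalerDl !scalerDr scalerN.
rewrite !opprD !scalerA (mulrC w.2) !addrA.
by rewrite [LHS](ACl (1*3*5*2*4*6)).
Qed.

Lemma ext_brC (u v : E) : ext_br u v = - ext_br v u.
Proof.
rewrite /ext_br; apply: injective_projections => /=; last by rewrite oppr0.
apply/funext => n; rewrite !fctE dp_brC !opprD opprK.
by congr (_ + _); exact: addrC.
Qed.

Lemma ext_brPr (a : K) (u v w : E) :
  ext_br w (a *: u + v) = a *: ext_br w u + ext_br w v.
Proof. by rewrite ext_brC ext_brPl opprD -scalerN -!ext_brC. Qed.

Lemma ext_brxx (u : E) : ext_br u u = 0.
Proof.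
apply: injective_projections => //=; apply/funext => n.
by rewrite !fctE dp_brxx subrr addr0.
Qed.

Lemma ext_jacobi (u v w : E) :
  ext_br u (ext_br v w) + ext_br v (ext_br w u) + ext_br w (ext_br u v) = 0.
Proof.
case: u v w => [f a] [g b] [h c].
apply: injective_projections => /=; last by rewrite !addr0.
rewrite !scale0r !subr0.
have sE (p q r s : nat -> A) (d e : K) : shift (dp_br p q + (d *: r - e *: s)) =
  dp_br (shift p) q + dp_br p (shift q) + (d *: shift r - e *: shift s) by [].
have bE (p q r s : nat -> A) (d e : K) : dp_br p (q + (d *: r - e *: s)) =
  dp_br p q + (d *: dp_br p r - e *: dp_br p s).
  by apply/funext => n; rewrite dp_brDr dp_brBr !dp_brZr.
rewrite !sE !bE; apply/funext => n; rewrite !fctE.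
rewrite !(scalerDr, scalerN, scalerA) !addrA.
rewrite (dp_brC (shift h) f) (dp_brC (shift g) h) (dp_brC (shift f) g).
(* Apart from the Jacobi identity of the series, the terms cancel in pairs. *)
rewrite [LHS](ACl ((1*8*15)*(2*11)*(3*19)*(4*16)*(5*10)*(6*14)*(7*20)*(9*18)
  *(12*17)*(13*21))) /=.
rewrite dp_br_jacobi !(mulrC b) (mulrC c a).
by rewrite !scalerN !(subrr, addNr, addr0).
Qed.

HB.instance Definition _ := Lmodule_isLieAlg.Build K E
  ext_brPl ext_brPr ext_brxx ext_jacobi.

End PowerExtension.

(** * Central polynomials vanish, by Lazard elimination *)

Arguments Cantor.to_nat : simpl never.
Arguments Cantor.of_nat : simpl never.

Section Elimination.
Variables (K : fieldType) (x : nat).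
Implicit Types (A : lieAlgType K) (M N : monomial) (P Q : seq (K * monomial)).

Definition next_letter (n : nat) : nat :=
  let: (y, k) := Cantor.of_nat n in Cantor.to_nat (y, k.+1).

(** The letters left once x has been eliminated: the code n of a pair (y, k)
    stands for ad(x)^k applied to the letter [bump x y], which runs over the
    letters other than x.  A bijective coding makes every n meaningful. *)
Definition elim_val A (rho : nat -> A) (n : nat) : A :=
  let: (y, k) := Cantor.of_nat n in iter k (lie_br (rho x)) (rho (bump x y)).

(** The monomials whose sum is the image of M under the derivation ad(x). *)
Fixpoint elim_deriv M : seq monomial :=
  match M with
  | Mvar n => [:: Mvar (next_letter n)]
  | Mbr M N => [seq Mbr M' N | M' <- elim_deriv M]
                 ++ [seq Mbr M N' | N' <- elim_deriv N]
  end.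

Definition poly_deriv P : seq (K * monomial) :=
  [seq (p.1, M) | p <- P, M <- elim_deriv p.2].

(** M rewritten in the letters left after the elimination of x; x itself cannot
    be rewritten, and the boolean records that M is that letter. *)
Fixpoint elim M : bool * seq (K * monomial) :=
  match M with
  | Mvar y => if y == x then (true, [::])
              else (false, [:: (1, Mvar (Cantor.to_nat (unbump x y, 0%N)))])
  | Mbr M N =>
      let: (c, Q) := elim M in
      let: (d, R) := elim N in
      (false, poly_br Q R ++ (if c then poly_deriv R else [::])
                ++ (if d then poly_scale (-1) (poly_deriv Q) else [::]))
  end.

Lemma elim_val_next A (rho : nat -> A) n :
  elim_val rho (next_letter n) = lie_br (rho x) (elim_val rho n).
Proof.
rewrite /elim_val /next_letter; case: (Cantor.of_nat n) => y k.
by rewrite /= Cantor.cancel_of_to.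
Qed.

Lemma eval_elim_deriv A (rho : nat -> A) M :
  \sum_(M' <- elim_deriv M) eval_mon (elim_val rho) M' =
  lie_br (rho x) (eval_mon (elim_val rho) M).
Proof.
elim: M => [n|M IM N IN] /=; first by rewrite big_seq1 /= elim_val_next.
rewrite big_cat !big_map /=.
have El (r : seq monomial) (z : A) :
  \sum_(M <- r) lie_br (eval_mon (elim_val rho) M) z =
  lie_br (\sum_(M <- r) eval_mon (elim_val rho) M) z.
  by elim: r => [|? r IH]; rewrite ?big_nil ?lie_br0l // !big_cons lie_brDl IH.
have Er (r : seq monomial) (z : A) :
  \sum_(M <- r) lie_br z (eval_mon (elim_val rho) M) =
  lie_br z (\sum_(M <- r) eval_mon (elim_val rho) M).
  by elim: r => [|? r IH]; rewrite ?big_nil ?lie_br0r // !big_cons lie_brDr IH.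
rewrite El Er IM IN (lie_br_ad (rho x)).
by rewrite subrK.
Qed.

Lemma eval_poly_deriv A (rho : nat -> A) P :
  eval_poly (elim_val rho) (poly_deriv P) =
  lie_br (rho x) (eval_poly (elim_val rho) P).
Proof.
rewrite /eval_poly big_allpairs_dep lie_br_sumr; apply: eq_bigr => p _ /=.
by rewrite -scaler_sumr eval_elim_deriv.
Qed.

Lemma eval_mon_elim A (rho : nat -> A) M :
  eval_mon rho M =
  (elim M).1%:R *: rho x + eval_poly (elim_val rho) (elim M).2.
Proof.
elim: M => [y|M IM N IN] /=.
  case: eqVneq => [->|yx] /=.
    by rewrite /eval_poly big_nil scale1r addr0.
  rewrite /eval_poly big_seq1 /= scale0r add0r scale1r /elim_val.
  by rewrite Cantor.cancel_of_to /= unbumpK // inE.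
rewrite {}IM {}IN; case: (elim M) => c Q; case: (elim N) => d R /=.
rewrite scale0r add0r !eval_cat eval_br.
set q := eval_poly _ Q; set r := eval_poly _ R.
have -> : eval_poly (elim_val rho) (if c then poly_deriv R else [::]) =
    c%:R *: lie_br (rho x) r.
  by case: c; rewrite ?scale1r ?scale0r ?eval_poly_deriv // /eval_poly big_nil.
have -> : eval_poly (elim_val rho)
    (if d then poly_scale (-1) (poly_deriv Q) else [::]) =
    - (d%:R *: lie_br (rho x) q).
  case: d; last by rewrite scale0r oppr0 /eval_poly big_nil.
  by rewrite eval_scale eval_poly_deriv scale1r scaleN1r.
rewrite lie_brDl !lie_brDr !lie_brZl !lie_brZr lie_brxx !scaler0 add0r.
by rewrite (lie_brC q (rho x)) scalerN addrA addrC.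
Qed.

Lemma mdegree_gt0 M : (0 < mdegree M)%N.
Proof. by rewrite lt0n size_eq0 (letters_neq0 (perm_refl _)). Qed.

Lemma mdegreeBr M N : mdegree (Mbr M N) = (mdegree M + mdegree N)%N.
Proof. exact: size_cat. Qed.

Lemma mdegree_elim_deriv M N : N \in elim_deriv M -> mdegree N = mdegree M.
Proof.
elim: M N => [n|M IM M' IM'] N /=; first by rewrite inE => /eqP ->.
rewrite mem_cat => /orP[] /mapP[N']; first by move=> /IM e ->; rewrite !mdegreeBr e.
by move=> /IM' e ->; rewrite !mdegreeBr e.
Qed.

(** Inside a bracket x is absorbed into a letter that stands for ad(x)^k y, which
    lowers the degree. *)
Lemma mdegree_elim M p :
  p \in (elim M).2 -> (mdegree p.2 + (x \in letters M) <= mdegree M)%N.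
Proof.
elim: M p => [y|M IM N IN] p /=.
  by case: eqVneq => //= yx; rewrite !inE => /eqP ->; rewrite eq_sym (negbTE yx).
have M0 := mdegree_gt0 M; have N0 := mdegree_gt0 N.
have cdeg M' : (elim M').1 -> mdegree M' = 1%N.
  by case: M' => //= M' N'; case: (elim M'); case: (elim N').
have dP Q p' : p' \in poly_deriv Q ->
    exists2 q, q \in Q & mdegree p'.2 = mdegree q.2.
  case/allpairsPdep=> q [M' [qQ M'q ->]]; exists q => //=.
  exact: mdegree_elim_deriv.
move: IM IN (cdeg M) (cdeg N); case: (elim M) => c Q; case: (elim N) => d R /=.
have bO (b b' : bool) : (b || b' <= b + b')%N by case: b b' => [] [].
have := bO (x \in letters M) (x \in letters N).
have b1 : (x \in letters M <= 1)%N by case: (_ \in _).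
have b2 : (x \in letters N <= 1)%N by case: (_ \in _).
have ar (o a b q m n : nat) :
  (o <= a + b -> a <= 1 -> m = 1 -> q + b <= n -> q + o <= m + n)%N by lia.
move=> bMN IM IN cM cN; rewrite mdegreeBr !mem_cat => /or3P[].
- case/allpairsP=> -[q r] [/= /IM qQ /IN rR ->] /=; rewrite mdegreeBr.
  lia.
- case: c cM => // /(_ isT) cM /dP[q /IN qR ->].
  exact: ar bMN b1 cM qR.
- case: d cN => // /(_ isT) cN /mapP[p' /dP[q /IM qQ e] ->].
  by rewrite /= e [leqRHS]addnC; apply: ar b2 cN qQ; rewrite addnC.
Qed.

(** A monomial without x is only relabelled. *)
Lemma size_elim M : (size (elim M).2 <= 1)%N \/ x \in letters M.
Proof.
suff H : x \notin letters M -> (elim M).1 = false /\ size (elim M).2 = 1%N.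
  by case: (boolP (x \in letters M)) => [|/H[_ ->]]; [right | left].
elim: M => [y|M IM N IN] /=; first by rewrite inE eq_sym => /negbTE ->.
rewrite mem_cat negb_or => /andP[/IM + /IN].
case: (elim M) (elim N) => c Q [d R] /= [-> sQ] [-> sR].
by rewrite !cats0 size_allpairs sQ sR.
Qed.

Definition poly_elim P : seq (K * monomial) :=
  flatten [seq poly_scale p.1 (elim p.2).2 | p <- P].

Lemma eval_poly_elim P : exists c : K, forall A (rho : nat -> A),
  eval_poly rho P = c *: rho x + eval_poly (elim_val rho) (poly_elim P).
Proof.
exists (\sum_(p <- P) p.1 * (elim p.2).1%:R) => A rho.
elim: P => [|p P IH].
  by rewrite /poly_elim /eval_poly !big_nil scale0r addr0.
rewrite /poly_elim /= eval_cat eval_scale big_cons scalerDl addrACA -IH.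
by rewrite /eval_poly big_cons eval_mon_elim scalerDr scalerA.
Qed.

Lemma mdegree_poly_elim D P :
  all (fun p => mdegree p.2 <= D)%N P ->
  all (fun p => mdegree p.2 <= D)%N (poly_elim P).
Proof.
move=> /allP PD; apply/allP => q /flatten_mapP[p pP /mapP[r rp ->]] /=.
by apply: leq_trans (PD _ pP); apply: leq_trans (mdegree_elim rp); rewrite leq_addr.
Qed.

(** The elimination of x decreases the number of monomials of the maximal degree D
    as soon as x occurs in one of them: the measure for the induction below. *)
Lemma count_poly_elim D P :
  all (fun p => mdegree p.2 <= D)%N P ->
  has (fun p => (mdegree p.2 == D) && (x \in letters p.2)) P ->
  (count (fun p => mdegree p.2 == D) (poly_elim P) <
   count (fun p => mdegree p.2 == D) P)%N.
Proof.
move=> PD; rewrite has_count => Px; rewrite -addn1.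
apply: leq_trans (_ : _ <= count (fun p => mdegree p.2 == D) (poly_elim P) +
  count (fun p => (mdegree p.2 == D) && (x \in letters p.2)) P)%N _.
  by rewrite leq_add2l.
elim: P {Px} PD => //= p P IH /andP[pD /IH{}IH]; rewrite count_cat addnACA.
apply: leq_add => //; rewrite /poly_scale count_map.
set c := count _ _.
have c0 : (forall q, q \in (elim p.2).2 -> mdegree q.2 < D)%N -> c = 0%N.
  move=> H; apply/eqP; rewrite -leqn0 leqNgt -has_count; apply/hasPn => q /H /=.
  by rewrite ltn_neqAle => /andP[].
have cs : (c <= size (elim p.2).2)%N by apply: count_size.
have := @mdegree_elim p.2.
case: (boolP (x \in letters p.2)) => xp dp.
  rewrite c0 ?andbT // => q /dp; lia.
rewrite andbF addn0; case: (size_elim p.2) => [s1|]; last by rewrite (negbTE xp).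
case: eqVneq => [_|pD']; first exact: leq_trans s1.
rewrite c0 // => q /dp; lia.
Qed.

End Elimination.

Section ExtEval.
Variables (K : fieldType) (B : lieAlgType K).
Local Notation E := (power_ext B).

Lemma ext_br0 (u v : E) :
  (lie_br u v).1 0%N = lie_br (u.1 0%N) (v.1 0%N)
    + ((u.2 : K) *: v.1 1%N - (v.2 : K) *: u.1 1%N).
Proof. by []. Qed.

Lemma ext_eval (rho : nat -> E) P : (forall n, (rho n).2 = 0) ->
  (eval_poly rho P).2 = 0 /\
  (eval_poly rho P).1 0%N = eval_poly (fun n => (rho n).1 0%N) P.
Proof.
move=> rho0.
have H M : (eval_mon rho M).2 = 0 /\
    (eval_mon rho M).1 0%N = eval_mon (fun n => (rho n).1 0%N) M.
  elim: M => [n|M [M0 M1] N [N0 N1]] /=; first by split.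
  split=> //; apply: etrans (ext_br0 _ _) _.
  by rewrite M0 N0 !scale0r subrr addr0 M1 N1.
rewrite /eval_poly; elim: P => [|p P [IH2 IH1]]; first by rewrite !big_nil.
rewrite !big_cons /= IH2 (H p.2).1 scaler0 addr0; split=> //.
by rewrite fctE IH1 -(H p.2).2.
Qed.

End ExtEval.

Section Witt.
Variable K : fieldType.
Implicit Types (P : seq (K * monomial)).

Definition central_values P := forall (A : lieAlgType K) (rho : nat -> A) z,
  lie_br (eval_poly rho P) z = 0.

(** With this choice for the original letters (x is d/dt, and every other y is a
    divided power series), the remaining letters have prescribed constant
    terms: the one with code n has constant term a n. *)
Definition elim_rho (B : lieAlgType K) x (a : nat -> B) (y : nat) : power_ext B :=
  if y == x then (0, 1) else
  (fun k => a (Cantor.to_nat (unbump x y, k)), 0).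

Lemma elim_val_rho (B : lieAlgType K) x (a : nat -> B) n :
  (elim_val x (elim_rho x a) n).2 = 0 /\
  (elim_val x (elim_rho x a) n).1 0%N = a n.
Proof.
rewrite /elim_val; case E: (Cantor.of_nat n) => [y k].
have bx : elim_rho x a (bump x y) = (fun j => a (Cantor.to_nat (y, j)), 0).
  by rewrite /elim_rho eq_sym (negbTE (neq_bump _ _)) bumpK.
rewrite !bx.
suff -> : iter k (lie_br (elim_rho x a x)) (fun j => a (Cantor.to_nat (y, j)), 0)
    = ((fun j => a (Cantor.to_nat (y, k + j)%N)), 0) :> power_ext B.
  by split=> //=; rewrite addn0 -E Cantor.cancel_to_of.
elim: k {E} => [|k IH] //=.
rewrite {}IH {1}/elim_rho eqxx.
apply: injective_projections => //=; apply/funext => j.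
rewrite !fctE (dp_brC _ _ j) dp_br0 oppr0 add0r scale1r scale0r subr0.
by rewrite /shift addSnnS.
Qed.

(** Eliminate a letter x that occurs in a monomial of maximal degree; then P becomes
    c x + Q with Q simpler.  In [power_ext B] send the remaining letters to
    series with arbitrary constant terms a.  The constant term of
    [[c x + Q, Z]] is [[Q(a), Z_0] + c Z_1], and it is 0 for all series Z.  Choosing
    Z_1 = 0 shows that Q has central values, so Q vanishes by induction; choosing
    Z_0 = 0 shows that c x vanishes. *)
Lemma central_values_vanish P : central_values P ->
  forall (A : lieAlgType K) (rho : nat -> A), eval_poly rho P = 0.
Proof.
have [D PD] : exists D, all (fun p => mdegree p.2 <= D)%N P.
  elim: P => [|p P [D PD]]; first by exists 0%N.
  exists (maxn (mdegree p.2) D); rewrite /= leq_maxl /=.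
  by apply: sub_all PD => q /leq_trans -> //; apply: leq_maxr.
elim: D P PD => [|D IHD] P.
  case: P => [_ _ A rho|p P /andP[]]; first by rewrite /eval_poly big_nil.
  by rewrite leqNgt mdegree_gt0.
have [n] := ubnP (count (fun p => mdegree p.2 == D.+1) P).
elim: n P => // n IHn P; rewrite ltnS => Pn PD cP.
case: (boolP (has (fun p => mdegree p.2 == D.+1) P)) => [/hasP[p pP /eqP pD]|nP].
  have [x xp] : exists x, x \in letters p.2.
    have := mdegree_gt0 p.2; rewrite /mdegree.
    by case: (letters p.2) => // x s _; exists x; rewrite inE eqxx.
  have [c cE] := eval_poly_elim x P.
  have eB (B : lieAlgType K) (a : nat -> B) (Z : nat -> B) :
      lie_br (eval_poly a (poly_elim x P)) (Z 0%N) + c *: Z 1%N = 0.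
    pose v := elim_val x (elim_rho x a).
    have [v2 v1] := ext_eval (poly_elim x P) (fun n => (elim_val_rho x a n).1).
    have := cP (power_ext B) (elim_rho x a) (Z, 0).
    rewrite cE; have -> : elim_rho x a x = (0, 1) by rewrite /elim_rho eqxx.
    rewrite -/v; set u := c *: _ + _ => u0.
    have := ext_br0 u (Z, 0); rewrite u0 /=.
    rewrite /u /= v2 !fctE v1.
    have z0 k : (0 : nat -> B) k = 0 by [].
    have -> : (fun n0 => (elim_val x (elim_rho x a) n0).1 0%N) = a.
      by apply/funext => k; have [] := elim_val_rho x a k.
    have -> : c%:A = c :> K^o by rewrite /GRing.scale /= mulr1.
    by rewrite !z0 scaler0 add0r addr0 scale0r subr0.
  have cQ : central_values (poly_elim x P).
    move=> B a z; have := eB B a (fun k => if k is 0 then z else 0).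
    by rewrite scaler0 addr0.
  have Q0 := IHn _ (leq_trans (count_poly_elim PD _) Pn) (mdegree_poly_elim x PD) cQ.
  move=> A rho; rewrite cE Q0 ?addr0; last first.
    by apply/hasP; exists p; rewrite ?pD ?eqxx.
  have := eB A (fun=> 0) (fun k => if k is 1 then rho x else 0).
  by rewrite lie_br0r add0r.
apply: IHD cP; apply/allP => p pP; rewrite -ltnS ltn_neqAle.
by rewrite (allP PD _ pP) andbT; apply: (hasPn nP).
Qed.

End Witt.

(** * Linearization of an identity *)

Section Coefficients.
Variable K : fieldType.
Implicit Types (P : seq (K * monomial)).

Definition assoc_coef P (w : seq nat) : K :=
  \sum_(p <- P) p.1 * assoc p.2 (fun v => (v == w)%:R).

Lemma assoc_coef_eq0 P (U : lmodType K) (phi : seq nat -> U) :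
  (forall w, assoc_coef P w = 0) -> \sum_(p <- P) p.1 *: assoc p.2 phi = 0.
Proof.
move=> P0; pose W := undup (flatten [seq permutations (letters p.2) | p <- P]).
transitivity (\sum_(w <- W) assoc_coef P w *: phi w); last first.
  by rewrite big1 // => w _; rewrite P0 scale0r.
under [RHS]eq_bigr do rewrite scaler_suml.
rewrite exchange_big; apply: eq_big_seq => p pP /=.
under [RHS]eq_bigr do rewrite -scalerA -assoc_delta.
rewrite -scaler_sumr -assoc_sum; congr (_ *: _); apply: assoc_eq => w wp.
have wW : w \in W.
  rewrite mem_undup; apply/flatten_mapP; exists p => //.
  by rewrite mem_permutations.
rewrite (big_rem w wW) /= eqxx scale1r big1_seq ?addr0 // => v /= vW.
case: eqP vW => [<-|]; last by rewrite scale0r.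
by rewrite mem_rem_uniq ?undup_uniq // inE eqxx.
Qed.

(** If all coefficients were 0, then ad of all values of P would be 0. *)
Lemma assoc_coef_exists P : eval_poly (@relfree_gen K (fun=> True)) P != 0 ->
  exists w, assoc_coef P w != 0.
Proof.
move=> P0; apply: contrapT => H; move/eqP: P0; apply.
apply: central_values_vanish => A rho z.
rewrite /eval_poly lie_br_suml.
under eq_bigr do rewrite lie_br_assoc.
apply: assoc_coef_eq0 => w; apply/eqP; apply: contrapT => /negP w0.
by apply: H; exists w.
Qed.

Lemma assoc_coef_size P d w : (forall p, p \in P -> mdegree p.2 = d) ->
  assoc_coef P w != 0 -> size w = d.
Proof.
move=> Pd; apply: contraNeq => wd; rewrite /assoc_coef big1_seq // => p /= pP.
rewrite (_ : assoc _ _ = 0) ?mulr0 // -[RHS](assoc0 _ p.2).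
apply: assoc_eq => v /perm_size; rewrite -[size (letters _)]/(mdegree _) Pd //.
by move=> vd; case: eqP => // vw; rewrite -vd vw eqxx in wd.
Qed.

Lemma span_eval_poly (A : lieAlgType K) (x : nat -> A) (C : monomial -> Prop) v :
  Defs.span [set u | exists2 M, C M & u = eval_mon x M] v ->
  exists P, (forall p, p \in P -> C p.2) /\ v = eval_poly x P.
Proof.
move=> [s [sC ->]]; elim: s sC => [|p s IH] sC.
  by exists [::]; rewrite /eval_poly !big_nil.
have [|P [PC e]] := IH; first by move=> q qs; apply: sC; rewrite inE qs orbT.
have [|M CM pM] := sC p; first by rewrite inE eqxx.
exists ((p.1, M) :: P); split; last by rewrite /eval_poly !big_cons e pM.
by move=> q; rewrite inE => /orP[/eqP ->|/PC].
Qed.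

End Coefficients.

Section Linearization.
Variables (c : nat -> nat) (I : seq nat).
Implicit Types (M N : monomial).

Definition fibre j := [seq p <- I | c p == j].

(** When each letter is replaced by the sum of the positions that [c] colours by it,
    M becomes the sum of its lifts. *)
Fixpoint lifts M : seq monomial :=
  match M with
  | Mvar j => [seq Mvar p | p <- fibre j]
  | Mbr M N => [seq Mbr M' N' | M' <- lifts M, N' <- lifts N]
  end.

Fixpoint lift_words (w : seq nat) : seq (seq nat) :=
  if w is j :: w' then [seq p :: v | p <- fibre j, v <- lift_words w']
  else [:: [::]].

Lemma lift_words_cat (U : nmodType) (phi : seq nat -> U) u v :
  \sum_(w <- lift_words (u ++ v)) phi w =
  \sum_(u' <- lift_words u) \sum_(v' <- lift_words v) phi (u' ++ v').
Proof.
elim: u phi => [|j u IH] phi /=; first by rewrite big_seq1.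
rewrite !big_allpairs_dep; apply: eq_bigr => p _.
exact: (IH (fun w => phi (p :: w))).
Qed.

(** Lifting commutes with associative expansion. *)
Lemma assoc_lifts (U : zmodType) M (phi : seq nat -> U) :
  \sum_(M' <- lifts M) assoc M' phi =
  assoc M (fun w => \sum_(v <- lift_words w) phi v).
Proof.
elim: M phi => [j|M IM N IN] phi.
  rewrite big_map -[RHS]/(\sum_(v <- lift_words [:: j]) phi v).
  suff -> : lift_words [:: j] = [seq [:: p] | p <- fibre j] by rewrite big_map.
  by rewrite /=; elim: (fibre j) => //= p s ->.
rewrite /= big_allpairs_dep exchange_big /=.
under eq_bigr do rewrite IM.
rewrite -assoc_sum; apply: assoc_eq => u _.
rewrite exchange_big /=; under eq_bigr do rewrite IN.
rewrite -assoc_sum; apply: assoc_eq => v _.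
rewrite !lift_words_cat [X in _ = _ - X]exchange_big -sumrB.
by apply: eq_bigr => u' _; rewrite -sumrB.
Qed.

Lemma mem_fibre j p : (p \in fibre j) = (c p == j) && (p \in I).
Proof. by rewrite mem_filter. Qed.

Lemma lifts_letters M M' : M' \in lifts M ->
  mdegree M' = mdegree M /\ all (mem I) (letters M').
Proof.
elim: M M' => [j|M IM N IN] M' /=.
  by case/mapP=> p; rewrite mem_fibre => /andP[_ pI] ->; rewrite /= pI.
case/allpairsP=> -[M1 N1] [/= /IM[dM aM] /IN[dN aN] ->].
by rewrite !mdegreeBr dM dN all_cat aM aN.
Qed.

Lemma mem_lift_words w v :
  (v \in lift_words w) = (map c v == w) && all (mem I) v.
Proof.
elim: w v => [|j w IH] [|p v] //=.
  by apply/negbTE/allpairsP => -[[? ?] []].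
apply/allpairsP/idP => [[[q u] [/= qj uw [-> ->]]]|].
  by move: qj uw; rewrite mem_fibre IH eqseq_cons => /andP[-> ->] /andP[-> ->].
rewrite eqseq_cons => /andP[/andP[cp cv] /andP[pI vI]].
by exists (p, v); rewrite mem_fibre IH cp cv pI vI.
Qed.

Lemma lift_words_uniq w : uniq I -> uniq (lift_words w).
Proof.
move=> uI; elim: w => //= j w IH; apply: allpairs_uniq => //.
  exact: filter_uniq.
by move=> [a b] [a' b'] _ _ [-> ->].
Qed.

Lemma sum_lift_words (U : nmodType) w (phi : seq nat -> U) : uniq I ->
  \sum_(v <- lift_words w | perm_eq v I) phi v =
  \sum_(v <- permutations I | map c v == w) phi v.
Proof.
move=> uI; rewrite -big_filter -[RHS]big_filter; apply: perm_big.
apply: uniq_perm; rewrite ?filter_uniq ?lift_words_uniq ?permutations_uniq //.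
move=> v; rewrite !mem_filter mem_lift_words mem_permutations.
case: (boolP (perm_eq v I)) => [vI|]; rewrite ?andbF //= andbT.
suff -> : all (mem I) v by rewrite andbT.
by apply/allP => p; rewrite (perm_mem vI).
Qed.

Section Identity.
Variables (K : fieldType) (A : lieAlgType K) (a : nat -> A).
Implicit Types (P : seq (K * monomial)).

Lemma eval_lifts (S : pred nat) M :
  eval_mon (fun j => \sum_(p <- fibre j | S p) a p) M =
  \sum_(M' <- lifts M | all S (letters M')) eval_mon a M'.
Proof.
elim: M => [j|M IM N IN] /=.
  by rewrite big_map; apply: eq_bigl => p; rewrite /= andbT.
rewrite {}IM {}IN.
have E (T : pred monomial) r z : lie_br (\sum_(M <- r | T M) eval_mon a M) z =
    \sum_(M <- r | T M) lie_br (eval_mon a M) z.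
  apply: (big_morph (fun y => lie_br y z)); [by move=> *; rewrite lie_brDl|].
  exact: lie_br0l.
have E' (T : pred monomial) r z : lie_br z (\sum_(M <- r | T M) eval_mon a M) =
    \sum_(M <- r | T M) lie_br z (eval_mon a M).
  apply: (big_morph (lie_br z)); [by move=> *; rewrite lie_brDr|].
  exact: lie_br0r.
rewrite E [RHS]big_mkcond big_allpairs_dep [LHS]big_mkcond.
apply: eq_bigr => M' _; rewrite E'.
case: ifP => SM; last by rewrite big1 // => N' _; rewrite /= all_cat SM.
by rewrite [LHS]big_mkcond; apply: eq_bigr => N' _; rewrite /= all_cat SM.
Qed.

(** Inclusion-exclusion, one required position at a time: the terms that involve
    r are all terms allowed by S minus those allowed by S without r. *)
Lemma lifts_identity P : (forall rho : nat -> A, eval_poly rho P = 0) ->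
  forall (S : pred nat) (R : seq nat),
  \sum_(p <- P) p.1 *: \sum_(M' <- lifts p.2 |
     all S (letters M') && all (mem (letters M')) R) eval_mon a M' = 0.
Proof.
move=> P0 S R; elim: R S => [|r R IH] S.
  have := P0 (fun j => \sum_(p <- fibre j | S p) a p); rewrite /eval_poly => e.
  rewrite -[RHS]e; apply: eq_bigr => p _; rewrite eval_lifts; congr (_ *: _).
  by apply: eq_bigl => M'; rewrite andbT.
pose F (T : pred nat) := \sum_(p <- P) p.1 *: \sum_(M' <- lifts p.2 |
  all T (letters M') && all (mem (letters M')) R) eval_mon a M'.
transitivity (F S - F (fun i => S i && (i != r))); last by rewrite /F !IH subr0.
rewrite -sumrB; apply: eq_bigr => p _; rewrite -scalerBr; congr (_ *: _).
rewrite [LHS]big_mkcond [X in _ = X - _]big_mkcond [X in _ = _ - X]big_mkcond.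
rewrite -sumrB; apply: eq_bigr => M' _ /=.
rewrite all_predI.
have -> : all (fun i => i != r) (letters M') = (r \notin letters M').
  by rewrite -has_pred1 -all_predC.
case: (all S _) => /=; last by rewrite subr0.
by case: (r \in _) => /=; case: (all _ R); rewrite ?subr0 ?subrr.
Qed.

(** The terms that involve all positions have degree at least [size I = d], so only
    P contributes, and only multilinear lifts.  The coefficient of the word s of
    positions is the coefficient in P of the word of its colours. *)
Lemma multilinear_part d P Q r : uniq I -> size I = d -> r \in I ->
  (forall p, p \in P -> mdegree p.2 = d) ->
  (forall p, p \in Q -> mdegree p.2 < d)%N ->
  (forall rho : nat -> A, eval_poly rho (Q ++ P) = 0) ->
  \sum_(s <- permutations I) assoc_coef P (map c s) *: right_normed a r s = 0.
Proof.
move=> uI sI rI Pd Qd H.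
have := lifts_identity H predT I; rewrite big_cat /= big1_seq ?add0r; last first.
  move=> p /= pQ; rewrite big1_seq ?scaler0 // => M' /andP[/andP[_ /allP IM'] M'p].
  have [dM _] := lifts_letters M'p.
  have := uniq_leq_size uI IM'; rewrite -[size (letters _)]/(mdegree _) dM sI.
  by rewrite leqNgt Qd.
move=> e; rewrite -[RHS]e {e}.
under [LHS]eq_bigr do rewrite scaler_suml.
rewrite exchange_big; apply: eq_big_seq => p pP /=.
under [LHS]eq_bigr do rewrite -scalerA -assoc_delta.
rewrite -scaler_sumr -assoc_sum; congr (_ *: _).
transitivity (\sum_(M' <- lifts p.2)
    assoc M' (fun w => if perm_eq w I then right_normed a r w else 0)).
  rewrite assoc_lifts; apply: assoc_eq => w _.
  rewrite -big_mkcond sum_lift_words // [RHS]big_mkcond.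
  by apply: eq_bigr => s _; rewrite eq_sym; case: ifP; rewrite ?scale1r ?scale0r.
rewrite [RHS]big_mkcond; apply: eq_big_seq => M' M'p /=.
have [dM aM] := lifts_letters M'p.
have sM : size (letters M') = size I by rewrite sI -(Pd _ pP) -dM.
have -> : all predT (letters M') by apply/allP.
case: ifP => /= IM.
  have IM' : {subset I <= letters M'} by apply/allP.
  have sM' : (size (letters M') <= size I)%N by rewrite sM.
  have pM : perm_eq (letters M') I.
    apply: uniq_perm => //; first exact: leq_size_uniq IM' sM'.
    by move=> i; have [_ ->] := uniq_min_size uI IM' sM'.
  rewrite (@eval_mon_right_normed _ _ _ r).
    by apply: assoc_eq => w wM; rewrite (perm_trans wM pM).
  by rewrite (permP pM) count_uniq_mem // rI.
rewrite -[RHS](assoc0 _ M'); apply: assoc_eq => w wM; case: ifP => // wI.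
case/negP: IM; apply/allP => i iI.
by rewrite inE -(perm_mem wM) (perm_mem wI).
Qed.

End Identity.
End Linearization.

(** * Straightening of words *)

Definition ad_identity (K : fieldType) (A : lieAlgType K) (k : nat)
    (beta : seq nat -> K) :=
  forall (a : nat -> A) (z : A),
    \sum_(s <- permutations (iota 0 k)) beta s *: ad_word a s z = 0.

Lemma ad_identity_of_right_normed (K : fieldType) (A : lieAlgType K) k
    (beta : seq nat -> K) :
  (forall a : nat -> A,
     \sum_(s <- permutations (iota 0 k.+1)) beta s *: right_normed a k s = 0) ->
  ad_identity A k (fun s => beta (rcons s k)).
Proof.
(* The last variable is the element on which the others act. *)
move=> H a z; pose b i := if i == k then z else a i.
have iS : iota 0 k.+1 = rcons (iota 0 k) k by rewrite -addn1 iotaD cats1.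
apply: etrans (H b); rewrite iS [RHS](bigID (fun s => last 0%N s == k)) /=.
rewrite [X in _ = _ + X]big1 ?addr0; last first.
  move=> s; case/lastP: s => [|s i]; first by rewrite scaler0.
  by rewrite last_rcons right_normed_rcons => /negbTE ->; rewrite scaler0.
rewrite -[RHS]big_filter; symmetry.
rewrite (perm_big [seq rcons s k | s <- permutations (iota 0 k)]) /=; last first.
  apply: uniq_perm; rewrite ?filter_uniq ?permutations_uniq //.
    by rewrite map_inj_uniq ?permutations_uniq // => s t /rcons_inj[].
  move=> w; rewrite mem_filter mem_permutations; apply/andP/mapP.
    case/lastP: w => [|w i]; first by case=> _ /perm_size; rewrite size_rcons.
    rewrite last_rcons => -[/eqP -> e]; exists w => //.
    rewrite mem_permutations; move: e.
    by rewrite -!cats1 perm_cat2r.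
  move=> [s]; rewrite mem_permutations => sk ->; rewrite last_rcons; split=> //.
  by rewrite -!cats1 perm_cat2r.
rewrite big_map; apply: eq_big_seq => s; rewrite mem_permutations => sk.
rewrite right_normed_rcons eqxx {2}/b eqxx; congr (_ *: _).
have : {in s, forall i, i < k}%N.
  by move=> i; rewrite (perm_mem sk) mem_iota.
elim: s {sk} => //= i s IH ik; rewrite IH; last first.
  by move=> j js; apply: ik; rewrite inE js orbT.
by rewrite /b ltn_eqF // ik // inE eqxx.
Qed.

Fixpoint lex_lt (u v : seq nat) : bool :=
  match u, v with
  | i :: u', j :: v' => (i < j)%N || (i == j) && lex_lt u' v'
  | _, _ => false
  end.

Lemma lex_lt_catl u r s : lex_lt r s -> lex_lt (u ++ r) (u ++ s).
Proof. by elim: u => //= i u IH /IH ->; rewrite eqxx orbT. Qed.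

Lemma lex_lt_catr u v r s : lex_lt u v -> lex_lt (u ++ r) (v ++ s).
Proof.
elim: u v => [|i u IH] [|j v] //= /orP[-> //|/andP[-> /IH ->]].
by rewrite orbT.
Qed.

(** Fixing the length is essential: 2, 12, 112, ... is an infinite descending chain
    of words. *)
Lemma lex_lt_ind (P : seq nat -> Prop) n :
  (forall w, size w = n ->
     (forall v, size v = n -> lex_lt v w -> P v) -> P w) ->
  forall w, size w = n -> P w.
Proof.
elim: n P => [|n IH] P H [|i w] //; first by move=> _; apply: H => // -[].
elim/ltn_ind: i w => i IHi w [sw]; move: w sw.
apply: (IH (fun w => P (i :: w))) => w sw IHw.
apply: H; rewrite /= ?sw // => -[|j v] //= [sv] /orP[ji|/andP[/eqP -> vw]].
  by apply: IHi => //; rewrite /= sv.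
exact: IHw.
Qed.

Section Below.
Variables (K : fieldType) (U : lmodType K).

Definition lex_below (w : seq nat) (phi : seq nat -> U) : set U :=
  Defs.span [set u | exists2 v, perm_eq v w && lex_lt v w & u = phi v].

Lemma span_morph (U' : lmodType K) (f : U -> U') (G : set U) (G' : set U') v :
  (forall a x y, f (a *: x + y) = a *: f x + f y) ->
  (forall u, G u -> Defs.span G' (f u)) -> Defs.span G v -> Defs.span G' (f v).
Proof.
move=> fP GG' [s [sG ->]]; elim: s sG => [|p s IH] sG.
  rewrite big_nil; suff -> : f 0 = 0 by apply: span0.
  by have := fP (-1) 0 0; rewrite scaler0 addr0 scaleN1r addNr.
rewrite big_cons fP; apply: spanP; first by apply/GG'/sG; rewrite inE eqxx.
by apply: IH => q qs; apply: sG; rewrite inE qs orbT.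
Qed.

Lemma span_sum (I : eqType) (r : seq I) (P : pred I) (a : I -> K) (f : I -> U)
    (G : set U) :
  (forall i, i \in r -> P i -> Defs.span G (f i)) ->
  Defs.span G (\sum_(i <- r | P i) a i *: f i).
Proof.
elim: r => [|i r IH] H; first by rewrite big_nil; apply: span0.
have Hr : Defs.span G (\sum_(j <- r | P j) a j *: f j).
  by apply: IH => j jr; apply: H; rewrite inE jr orbT.
rewrite big_cons; case: ifP => // Pi; apply: spanP => //.
by apply: H; rewrite ?inE ?eqxx.
Qed.

Definition left_normed (b : seq nat) : monomial :=
  foldl (fun M i => Mbr M (Mvar i)) (Mvar (head 0%N b)) (behead b).

Lemma letters_left_normed b : b != [::] -> letters (left_normed b) = b.
Proof.
case: b => // h t _; rewrite /left_normed /=.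
elim/last_ind: t => //= t i IH.
by rewrite foldl_rcons /= IH cats1.
Qed.

(** Only the terms u i of the brackets [[u, i] = u i - i u] keep h in front. *)
Lemma assoc_left_normed h t (phi : seq nat -> U) : h \notin t ->
  Defs.span [set u | exists2 w, perm_eq w (h :: t) && (head 0%N w != h) & u = phi w]
    (assoc (left_normed (h :: t)) phi - phi (h :: t)).
Proof.
elim/last_ind: t phi => [|t i IH] phi.
  by move=> _; rewrite /= subrr; apply: span0.
rewrite mem_rcons inE negb_or => /andP[hi ht].
have -> : left_normed (h :: rcons t i) = Mbr (left_normed (h :: t)) (Mvar i).
  by rewrite /left_normed /= foldl_rcons.
rewrite [assoc _ _]/=.
have pm u : perm_eq u (h :: t) ->
    perm_eq (u ++ [:: i]) (h :: rcons t i) /\ perm_eq (i :: u) (h :: rcons t i).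
  move=> uh; have e : perm_eq (u ++ [:: i]) (h :: rcons t i).
    by rewrite -cats1 -cat_cons perm_cat2r.
  by split=> //; rewrite -cat1s perm_catC.
set psi := fun u => phi (u ++ [:: i]) - phi ([:: i] ++ u).
have -> : assoc (left_normed (h :: t)) psi - phi (h :: rcons t i) =
    -1 *: phi (i :: h :: t) + (assoc (left_normed (h :: t)) psi - psi (h :: t)).
  by rewrite /psi scaleN1r /= cats1 opprB addrCA addKr.
apply: spanP.
  apply: span_sub; exists (i :: h :: t) => //=.
  by rewrite (pm _ (perm_refl _)).2 eq_sym.
apply: (@span_morph _ id) (IH psi ht) => // _ [u /andP[uh hu] ->].
have [e1 e2] := pm _ uh.
rewrite /psi addrC -scaleN1r; apply: spanP; apply: span_sub.
  by exists (i :: u); rewrite //= e2 eq_sym.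
exists (u ++ [:: i]); rewrite // e1 /=.
by case: (u) hu uh => [|? ?] //= _ /perm_size.
Qed.

(** When the head is the maximum, words that do not start with it are smaller. *)
Lemma assoc_left_normed_below b (phi : seq nat -> U) :
  b != [::] -> all (gtn (head 0%N b)) (behead b) ->
  lex_below b phi (assoc (left_normed b) phi - phi b).
Proof.
case: b => // h t _ /= /allP ht.
have hNt : h \notin t by apply/negP => /ht /=; rewrite ltnn.
apply: (@span_morph _ id) (assoc_left_normed phi hNt) => // _ [w /andP[wh hw] ->].
apply: span_sub; exists w; rewrite // wh /=.
case: w hw wh => [|i w] /= ih wh; first by have := perm_size wh.
have := mem_head i w; rewrite (perm_mem wh) inE (negbTE ih) /= => /ht /= ->.
by [].
Qed.

End Below.

(** The head of each block exceeds all later letters of the chain.  Reading a word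
    as a decreasing forest, each head is thus an ancestor of the next one. *)
Fixpoint block_chain (bs : seq (seq nat)) : bool :=
  if bs is b :: bs' then
    [&& b != [::], all (gtn (head 0%N b)) (behead b ++ flatten bs')
      & block_chain bs']
  else true.

Section Blocks.
Variables (K : fieldType) (A : lieAlgType K) (x : nat -> A).
Implicit Types (b w : seq nat) (z : A).

Definition block_act (bs : seq (seq nat)) z : A :=
  foldr (fun b => lie_br (eval_mon x (left_normed b))) z bs.

Local Notation lex_belowx w z := (lex_below w (ad_word x ^~ z)).

Lemma lie_br_block b r w z : b != [::] -> all (gtn (head 0%N b)) (behead b) ->
  perm_eq r w -> r = w \/ lex_lt r w ->
  lex_belowx (b ++ w) z
    (lie_br (eval_mon x (left_normed b)) (ad_word x r z) - ad_word x (b ++ r) z).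
Proof.
move=> b0 bh rw le; rewrite lie_br_assoc ad_word_cat.
apply: (@span_morph _ _ _ id) (assoc_left_normed_below _ b0 bh) => //.
move=> _ [u /andP[ub lub] ->]; rewrite -ad_word_cat; apply: span_sub.
by exists (u ++ r); rewrite // perm_cat //= lex_lt_catr.
Qed.

Lemma lie_br_below b w z e : b != [::] -> all (gtn (head 0%N b)) (behead b) ->
  lex_belowx w z e -> lex_belowx (b ++ w) z (lie_br (eval_mon x (left_normed b)) e).
Proof.
move=> b0 bh; apply: span_morph => [a y y'|]; first exact: lie_brPr.
move=> _ [v /andP[vw lvw] ->].
rewrite -[lie_br _ _](subrK (ad_word x (b ++ v) z)) addrC -[ad_word x _ z]scale1r.
apply: spanP; last by rewrite scale1r; apply: lie_br_block => //; right.
by apply: span_sub; exists (b ++ v); rewrite // perm_cat2l vw lex_lt_catl.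
Qed.

Lemma block_act_lead bs z : block_chain bs ->
  lex_belowx (flatten bs) z (block_act bs z - ad_word x (flatten bs) z).
Proof.
elim: bs => [_|b bs IH] /=; first by rewrite subrr; apply: span0.
case/and3P=> b0; rewrite all_cat => /andP[bh _] /IH{}IH.
rewrite -[block_act bs z](subrK (ad_word x (flatten bs) z)) lie_brDr -addrA.
rewrite -[lie_br _ (block_act bs z - _)]scale1r; apply: spanP.
  exact: lie_br_below.
by apply: lie_br_block => //; left.
Qed.

Lemma block_act_span bs z : all (fun b => b != [::]) bs ->
  Defs.span [set u | exists2 w, perm_eq w (flatten bs) & u = ad_word x w z]
    (block_act bs z).
Proof.
elim: bs => [_|b bs IH] /=; first by apply: span_sub; exists [::].
case/andP=> b0 /IH; apply: span_morph => [a y y'|]; first exact: lie_brPr.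
move=> _ [v vw ->]; rewrite lie_br_assoc.
apply: assoc_span => u; rewrite letters_left_normed // => ub.
by rewrite -ad_word_cat; apply: span_sub; exists (u ++ v); rewrite // perm_cat.
Qed.

Lemma block_chain_neq0 bs : block_chain bs -> all (fun b => b != [::]) bs.
Proof. by elim: bs => //= b bs IH /and3P[-> _ /IH]. Qed.

(** At the first block where cs departs from bs, the block of cs comes from further
    down the chain, so that all its letters lie below the head of the one in bs. *)
Lemma block_act_below bs cs z : block_chain bs -> perm_eq cs bs -> cs != bs ->
  lex_belowx (flatten bs) z (block_act cs z).
Proof.
elim: bs cs => [|b bs IH] cs /=.
  by move=> _ /perm_size; case: cs.
case: cs => [|c cs]; first by move=> _ /perm_size.
move=> /and3P[b0]; rewrite all_cat => /andP[bh /allP bbs] cbs.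
case: (eqVneq c b) => [->|cb].
  rewrite perm_cons eqseq_cons eqxx /= => cs_bs ne.
  by apply: lie_br_below => //; apply: IH.
move=> pcs _.
have cIbs : c \in bs.
  by have := mem_head c cs; rewrite (perm_mem pcs) inE (negbTE cb).
have c0 : c != [::] by apply: (allP (block_chain_neq0 cbs)).
have cs0 : all (fun b => b != [::]) cs.
  have : all (fun b => b != [::]) (c :: cs).
    by rewrite (perm_all _ pcs) /= b0 block_chain_neq0.
  by case/andP.
move: (block_act_span z cs0); apply: span_morph => [a y y'|]; first exact: lie_brPr.
move=> _ [v vw ->]; rewrite lie_br_assoc.
apply: assoc_span => u; rewrite letters_left_normed // => uc.
rewrite -ad_word_cat; apply: span_sub; exists (u ++ v) => //.
have -> /= : perm_eq (u ++ v) (b ++ flatten bs).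
  by apply: perm_trans (perm_flatten pcs); rewrite /= perm_cat.
case: u uc => [|i u] uc.
  by case: c c0 uc {cb pcs cIbs} => // ? ? _ /perm_size.
case: b b0 bbs {bh cb pcs} => //= h t _ bbs; rewrite bbs //.
by apply/flattenP; exists c => //; rewrite -(perm_mem uc) mem_head.
Qed.

(** In terms of forests: some path in the forest of w has k vertices. *)
Definition reducible (k : nat) (w : seq nat) : Prop :=
  exists p bs q, [/\ w = p ++ flatten bs ++ q, size bs = k & block_chain bs].

Lemma block_chain_uniq bs : block_chain bs -> uniq bs.
Proof.
elim: bs => //= b bs IH /and3P[b0].
rewrite all_cat => /andP[_ /allP bbs] /[dup] cbs /IH ->.
rewrite andbT; apply/negP => bIbs; have := bbs (head 0%N b).
rewrite /= ltnn => H; suff : false by []; apply: H.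
by apply/flattenP; exists b => //; case: (b) b0 => // i ? _; rewrite mem_head.
Qed.

(** Apply the identity to the left-normed brackets of the k blocks and the element
    on which they act.  The identity permutation contributes a nonzero multiple of
    the word plus smaller words, and every other permutation only smaller words. *)
Lemma ad_word_reducible k (beta : seq nat -> K) w z :
  ad_identity A k beta -> beta (iota 0 k) != 0 -> reducible k w ->
  lex_belowx w z (ad_word x w z).
Proof.
move=> idA b0 [p [bs [q [-> sbs cbs]]]]; set t := ad_word x q z.
suff H : lex_belowx (flatten bs) t (ad_word x (flatten bs) t).
  rewrite !ad_word_cat -/t; apply: span_morph H => [a y y'|]; first exact: ad_wordP.
  move=> _ [v /andP[vw lvw] ->].
  rewrite /t -[ad_word x v _]ad_word_cat -ad_word_cat; apply: span_sub.
  exists (p ++ v ++ q); rewrite // perm_cat2l perm_cat2r vw.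
  by rewrite lex_lt_catl // lex_lt_catr.
pose a j := eval_mon x (left_normed (nth [::] bs j)).
have aE s : ad_word a s t = block_act (map (nth [::] bs) s) t.
  by elim: s => //= j s ->.
have e : block_act bs t = \sum_(s <- permutations (iota 0 k) | s != iota 0 k)
    (- (beta (iota 0 k))^-1 * beta s) *: ad_word a s t.
  have := idA a t.
  rewrite (bigD1_seq (iota 0 k)) ?mem_permutations ?permutations_uniq //=.
  move/eqP; rewrite addr_eq0 => /eqP H.
  under eq_bigr do rewrite -scalerA.
  rewrite -scaler_sumr scaleNr -scalerN -H scalerA mulVf // scale1r aE.
  by rewrite -sbs map_nth_iota0 // take_size.
have Hb : lex_belowx (flatten bs) t (block_act bs t).
  rewrite e; apply: span_sum => s; rewrite mem_permutations => sk ne.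
  rewrite aE; apply: block_act_below => //.
    by rewrite (perm_trans (perm_map _ sk)) // -sbs map_nth_iota0 // take_size.
  apply: contraNneq ne => E; apply/eqP/(@eq_from_nth _ 0%N).
    by rewrite (perm_size sk).
  move=> i isz; have ik : (i < k)%N by rewrite -(size_iota 0 k) -(perm_size sk).
  have sik : (nth 0%N s i < k)%N.
    by have := mem_nth 0%N isz; rewrite (perm_mem sk) mem_iota.
  apply/eqP; rewrite nth_iota // add0n.
  rewrite -(nth_uniq [::] _ _ (block_chain_uniq cbs)) ?sbs //.
  by rewrite -(nth_map 0%N [::] (nth [::] bs)) // E.
have -> : ad_word x (flatten bs) t =
    -1 *: (block_act bs t - ad_word x (flatten bs) t) + block_act bs t.
  by rewrite scaleN1r opprB subrK.
by apply: spanP => //; apply: block_act_lead.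
Qed.

Lemma ad_word_irreducible_span k (beta : seq nat -> K) w z :
  ad_identity A k beta -> beta (iota 0 k) != 0 ->
  Defs.span [set u | exists2 v, perm_eq v w /\ ~ reducible k v & u = ad_word x v z]
    (ad_word x w z).
Proof.
move=> idA b0; have [n] : exists n, size w = n by exists (size w).
move: w; apply: lex_lt_ind => w sw IH.
have [rw|nw] := pselect (reducible k w); last by apply: span_sub; exists w.
apply: (@span_morph _ _ _ idfun) (ad_word_reducible z idA b0 rw) => //.
move=> _ [v /andP[vw lvw] ->] /=.
apply: (@span_morph _ _ _ idfun) (IH v _ lvw) => //; last by rewrite (perm_size vw).
move=> _ [u [uv nu] ->]; apply: span_sub; exists u => //; split=> //.
exact: perm_trans uv vw.
Qed.

End Blocks.

(** * The exponential recursion *)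

Section Series.
Variable R : realType.
Implicit Types (f g : fps R).

Lemma coef_poly_exp f N k n : (n <= N)%N ->
  ((\poly_(i < N.+1) f i) ^+ k)`_n = fps_pow f k n.
Proof.
elim: k n => [|k IH] n nN; first by rewrite expr0 coef1.
rewrite exprS coefM; apply: eq_bigr => -[i /= ilt] _.
rewrite coef_poly ltnS (leq_trans _ nN) // IH //.
by rewrite (leq_trans _ nN) // leq_subr.
Qed.

(** (f^(k+1))' = (k+1) f' f^k, read off from truncations of f to polynomials. *)
Lemma fps_pow_deriv f k n :
  (n.+1)%:R * fps_pow f k.+1 n.+1 =
  k.+1%:R * \sum_(i < n.+1) i.+1%:R * f i.+1 * fps_pow f k (n - i)%N.
Proof.
pose p : {poly R} := \poly_(i < n.+2) f i.
have := congr1 (fun q : {poly R} => q`_n) (deriv_exp p k.+1).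
rewrite coef_deriv coef_poly_exp // coefMn coefM mulr_natl => ->.
rewrite mulr_natl; congr (_ *+ _); apply: eq_bigr => -[i /= ilt] _.
rewrite coef_deriv coef_poly ltnS ilt coef_poly_exp; last first.
  by rewrite (leq_trans (leq_subr _ _)).
by rewrite mulr_natl.
Qed.

(** (exp f)' = f' exp f. *)
Lemma fps_exp_deriv f n : f 0%N = 0 ->
  (n.+1)%:R * fps_exp f n.+1 =
  \sum_(i < n.+1) i.+1%:R * f i.+1 * fps_exp f (n - i)%N.
Proof.
move=> f0; rewrite /fps_exp big_ord_recl /= [fps_one R _]/(_%:R) /= mul0r add0r.
rewrite mulr_sumr.
transitivity (\sum_(k < n.+1) \sum_(i < n.+1)
    i.+1%:R * f i.+1 * (fps_pow f k (n - i)%N / k`!%:R)).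
  apply: eq_bigr => k _; rewrite mulrA fps_pow_deriv factS natrM invfM.
  rewrite mulrACA divff ?pnatr_eq0 // mul1r mulr_suml.
  by apply: eq_bigr => i _; rewrite mulrA.
rewrite exchange_big; apply: eq_bigr => -[i /= ilt] _.
rewrite -mulr_sumr; congr (_ * _).
rewrite [RHS](big_ord_widen_cond n.+1 xpredT
  (fun k => fps_pow f k (n - i)%N / k`!%:R)).
  rewrite [RHS]big_mkcond /=; apply: eq_bigr => k _; case: ltnP => // ik.
  by rewrite fps_pow_small ?mul0r.
by rewrite ltnS leq_subr.
Qed.

Lemma fps_mulX g n : fps_mul (fps_X R) g n.+1 = g n.
Proof.
rewrite /fps_mul 2!big_ord_recl /fps_X /= mul0r add0r mul1r subn1 /=.
by rewrite big1 ?addr0 // => i _; rewrite mul0r.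
Qed.

(** The coefficient of z^n in F_d, where F_0 = 1 and F_{d+1} = exp (z F_d).  It is
    1/n! times the number of labelled rooted forests on n vertices with at most d
    levels. *)
Definition forests d n : R := r_tilde R d.+2 n.+1.

Lemma forestsS d n : forests d.+1 n = fps_exp (r_tilde R d.+2) n.
Proof. by rewrite /forests r_tildeS // fps_mulX. Qed.

Lemma forests0 d : forests d 0 = 1.
Proof.
case: d => [|d]; first by [].
by rewrite forestsS /fps_exp big_ord1 /= divr1.
Qed.

Lemma forests_deriv d n : n.+1%:R * forests d.+1 n.+1 =
  \sum_(i < n.+1) i.+1%:R * forests d i * forests d.+1 (n - i)%N.
Proof.
rewrite forestsS fps_exp_deriv ?r_tilde_coef0 //.
by apply: eq_bigr => i _; rewrite -forestsS.
Qed.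

Lemma forests_ge0 d n : 0 <= forests d n.
Proof.
elim: d n => [|d IH] n; first by rewrite /forests /r_tilde /= /fps_X ler0n.
elim/ltn_ind: n => -[|n] IHn; first by rewrite forests0.
rewrite -(pmulr_rge0 _ (ltr0Sn R n)) forests_deriv.
by apply: sumr_ge0 => i _; rewrite !mulr_ge0 // IHn // ltnS leq_subr.
Qed.

Lemma forests_conv_le d n :
  \sum_(i < n.+1) forests d.+1 (n - i)%N * forests d i <=
  n.+1%:R * forests d.+1 n.+1.
Proof.
rewrite forests_deriv; apply: ler_sum => i _.
rewrite [leLHS]mulrC ler_wpM2r ?forests_ge0 // ler_peMl ?forests_ge0 //.
by rewrite ler1n.
Qed.

End Series.

(** * Counting irreducible words *)

Fixpoint splits (T : Type) (s : seq T) : seq (seq T * seq T) :=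
  if s is x :: s' then
    [seq (x :: p.1, p.2) | p <- splits s'] ++ [seq (p.1, x :: p.2) | p <- splits s']
  else [:: ([::], [::])].

Lemma mem_splits (T : eqType) (a : pred T) (s : seq T) :
  (filter a s, filter (predC a) s) \in splits s.
Proof.
elim: s => //= x s IH; rewrite mem_cat; case: (a x) => /=; apply/orP.
  by left; apply/mapP; exists (filter a s, filter (predC a) s).
by right; apply/mapP; exists (filter a s, filter (predC a) s).
Qed.

Lemma splits_subseq (T : eqType) (s : seq T) p : p \in splits s ->
  [/\ subseq p.1 s, subseq p.2 s & (size p.1 + size p.2 = size s)%N].
Proof.
elim: s p => [|x s IH] p /=; first by rewrite inE => /eqP ->.
rewrite mem_cat => /orP[] /mapP[q /IH[q1 q2 <-] ->] /=.
  by rewrite eqxx; split=> //; apply: subseq_trans q2 (subseq_cons _ _).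
by rewrite eqxx addnS; split=> //; apply: subseq_trans q1 (subseq_cons _ _).
Qed.

(** The product rule for exponential generating functions. *)
Lemma sum_splits (R : comNzRingType) (T : Type) (s : seq T) (f g : nat -> R) :
  \sum_(p <- splits s) f (size p.1) * g (size p.2) =
  \sum_(i < (size s).+1) 'C(size s, i)%:R * (f (size s - i)%N * g i).
Proof.
elim: s f g => [|x s IH] f g /=; first by rewrite big_seq1 big_ord1 mul1r.
rewrite big_cat !big_map /= (IH (fun n => f n.+1)) (IH f (fun n => g n.+1)).
set n := size s.
rewrite [RHS]big_ord_recl bin0 subn0.
under [X in _ = _ + X]eq_bigr do rewrite binS natrD mulrDl subSS.
rewrite big_split addrA /=; congr (_ + _).
rewrite [X in _ = _ + X]big_ord_recr /= bin_small // mul0r addr0.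
rewrite big_ord_recl bin0 subn0; congr (_ + _).
by apply: eq_bigr => i _; rewrite subnSK.
Qed.

Section Counting.
Variable R : realType.

Lemma exists_max (s : seq nat) : (0 < size s)%N ->
  exists2 M, M \in s & {in s, forall i, i <= M}%N.
Proof.
elim: s => // i [|j s] IH _.
  by exists i; rewrite ?mem_head // => k; rewrite inE => /eqP ->.
have [M Ms Mmax] := IH isT.
exists (maxn i M); first by case: leqP => _; rewrite inE ?eqxx ?Ms ?orbT.
move=> k; rewrite inE leq_max => /orP[/eqP ->|/Mmax ->]; rewrite ?leqnn ?orbT //.
Qed.

Lemma reducible_catr k u r : reducible k u -> reducible k (u ++ r).
Proof.
by move=> [p [bs [q [-> sbs cbs]]]]; exists p, bs, (q ++ r); rewrite -!catA.
Qed.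

(** The letters after i in [i :: v] are descendants of i, so a path in v extends to
    a path that starts at i. *)
Lemma reducible_cons k u i v : all (gtn i) v -> reducible k v ->
  reducible k.+1 (u ++ i :: v).
Proof.
move=> iv [p [bs [q [ev sbs cbs]]]]; exists u, ((i :: p) :: bs), q; split=> /=.
- by rewrite ev !catA.
- by rewrite sbs.
- by rewrite cbs andbT; move: iv; rewrite ev catA all_cat => /andP[].
Qed.

(** If a word u ++ M :: v with largest letter M has no path of d + 2 vertices, then
    neither has u, and v has none of d + 1 vertices since M extends every path
    of v.  The distribution of the other letters between u and v is one of
    their splits. *)
Lemma irreducible_words d n (s : seq nat) : uniq s -> size s = n ->
  exists l : seq (seq nat),
    (forall w, perm_eq w s -> ~ reducible d.+1 w -> w \in l) /\
    (size l)%:R <= n`!%:R * forests R d n.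
Proof.
elim: d n s => [|d IHd] n s; last (elim/ltn_ind: n s => n IHn s).
  case: n => [|n] us ss.
    exists [:: [::]]; rewrite forests0 mulr1 lexx; split=> // w.
    by rewrite (size0nil ss) => /perm_nilP ->.
  exists [::]; split; last by rewrite mulr_ge0 ?forests_ge0.
  move=> w /perm_size; rewrite ss => sw [].
  case: w sw => // i w _; exists [::], [:: [:: i]], w.
  by split.
case: n IHn => [|n] IHn us ss.
  exists [:: [::]]; rewrite forests0 mulr1 lexx; split=> // w.
  by rewrite (size0nil ss) => /perm_nilP ->.
have [M Ms Mmax] : exists2 M, M \in s & {in s, forall i, i <= M}%N.
  by apply: exists_max; rewrite ss.
pose s' := rem M s.
have us' : uniq s' by apply: rem_uniq.
have ss' : size s' = n by rewrite size_rem // ss.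
have s'M : all (gtn M) s'.
  apply/allP => i; rewrite mem_rem_uniq // inE => /andP[iM /Mmax] /=.
  by rewrite ltn_neqAle iM.
have /choice[L1 L1P] (t : seq nat) : exists l : seq (seq nat),
    uniq t -> (size t <= n)%N ->
    (forall w, perm_eq w t -> ~ reducible d.+2 w -> w \in l) /\
    (size l)%:R <= (size t)`!%:R * forests R d.+1 (size t).
  have [/andP[ut st]|nt] := boolP (uniq t && (size t <= n)%N).
    by have [l lP] := IHn _ st t ut erefl; exists l.
  by exists [::] => ut st; rewrite ut st in nt.
have /choice[L2 L2P] (t : seq nat) : exists l : seq (seq nat), uniq t ->
    (forall w, perm_eq w t -> ~ reducible d.+1 w -> w \in l) /\
    (size l)%:R <= (size t)`!%:R * forests R d (size t).
  have [ut|nt] := boolP (uniq t); last by exists [::].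
  by have [l lP] := IHd _ t ut erefl; exists l.
exists (flatten [seq [seq u ++ M :: v | u <- L1 p.1, v <- L2 p.2] | p <- splits s']).
split.
  move=> w ws nw; have Mw : M \in w by rewrite (perm_mem ws).
  case/splitPr: w / Mw ws nw => u v ws nw.
  have uvs' : perm_eq (u ++ v) s'.
    rewrite -(perm_cons M).
    apply: perm_trans (perm_trans ws (perm_to_rem Ms)).
    by rewrite -[M :: u ++ v]cat1s perm_catCA.
  have uuv : uniq (u ++ v) by rewrite (perm_uniq uvs').
  apply/flatten_mapP; exists (filter (mem u) s', filter (predC (mem u)) s').
    exact: mem_splits.
  have /and3P[uu /hasPn uv uv'] : [&& uniq u, ~~ has (mem u) v & uniq v].
    by rewrite -cat_uniq.
  have ku : perm_eq u (filter (mem u) s').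
    rewrite perm_sym; apply: perm_trans (perm_filter _ _) _.
      by rewrite perm_sym; exact: uvs'.
    rewrite filter_cat (all_filterP _); last by apply/allP.
    by rewrite (eq_in_filter (a2 := pred0)) ?filter_pred0 ?cats0 // => i /uv /negbTE.
  have kv : perm_eq v (filter (predC (mem u)) s').
    rewrite perm_sym; apply: perm_trans (perm_filter _ _) _.
      by rewrite perm_sym; exact: uvs'.
    rewrite filter_cat (eq_in_filter (a2 := pred0) (s := u)) ?filter_pred0.
      by rewrite (all_filterP _) //; apply/allP => i /uv.
    by move=> i /= ->.
  have u1 : uniq (filter (mem u) s') by apply: filter_uniq.
  have u2 : uniq (filter (predC (mem u)) s') by apply: filter_uniq.
  apply: allpairs_f.
    apply: (L1P _ u1 _).1 => //.
      by rewrite -ss' size_filter count_size.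
    by move=> /reducible_catr.
  apply: (L2P _ u2).1 => // rv; apply: nw; apply: reducible_cons rv.
  apply/allP => i iv; apply: (allP s'M); rewrite -(perm_mem uvs') mem_cat iv.
  by rewrite orbT.
rewrite size_flatten /shape -map_comp sumnE big_map natr_sum.
apply: (@le_trans _ _ (\sum_(p <- splits s')
    ((size p.1)`!%:R * forests R d.+1 (size p.1)) *
    ((size p.2)`!%:R * forests R d (size p.2)))).
  rewrite big_seq [leRHS]big_seq; apply: ler_sum => -[a b] /= pab.
  have [sa sb sab] := splits_subseq pab.
  rewrite size_allpairs natrM ler_pM //.
    apply: (L1P a _ _).2; first exact: subseq_uniq sa us'.
    by rewrite -ss'; apply: size_subseq.
  exact/(L2P b _).2/(subseq_uniq sb us').
rewrite (sum_splits _ (fun i => i`!%:R * forests R d.+1 i)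
  (fun i => i`!%:R * forests R d i)) ss'.
apply: (@le_trans _ _ (n`!%:R *
    \sum_(i < n.+1) forests R d.+1 (n - i)%N * forests R d i)); last first.
  rewrite factS natrM [X in _ <= X * _]mulrC -mulrA.
  by rewrite ler_wpM2l ?ler0n // forests_conv_le.
rewrite mulr_sumr; apply: ler_sum => -[i /= ilt] _.
rewrite -(@bin_fact n i) // !natrM.
by rewrite le_eqVlt; apply/orP; left; apply/eqP; ring.
Qed.

End Counting.

(** * The codimension bound *)

Section Dimension.
Variables (K : fieldType) (U : lmodType K).

Lemma has_dim_le (I : eqType) (l : seq I) (phi : I -> U) (W : set U) d :
  has_dim W d ->
  (forall w, W w -> Defs.span [set u | exists2 i, i \in l & u = phi i] w) ->
  (d <= size l)%N.
Proof.
move=> [b [bW bi _]] Wl.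
have spanE w : Defs.span [set u | exists2 i, i \in l & u = phi i] w ->
    exists a : 'I_(size l) -> K, w = \sum_j a j *: phi (tnth (in_tuple l) j).
  case=> s [sl ->]; elim: s sl => [|p s IH] sl.
    by exists (fun=> 0); rewrite big_nil big1 // => j _; rewrite scale0r.
  have [|a e] := IH; first by move=> q qs; apply: sl; rewrite inE qs orbT.
  have [|i il pi] := sl p; first by rewrite inE eqxx.
  have /seq_tnthP[j ji] := il.
  exists (fun k => (k == j)%:R * p.1 + a k); rewrite big_cons e pi ji.
  under [RHS]eq_bigr do rewrite scalerDl -scalerA.
  rewrite big_split [X in _ = X + _](bigD1 j) //= eqxx scale1r.
  rewrite [X in _ = _ + X + _]big1 ?addr0 //.
  by move=> k /negbTE ->; rewrite scale0r.
have /choice[f fE] i := spanE _ (Wl _ (bW i)).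
pose M : 'M[K]_(d, size l) := \matrix_(i, j) f i j.
suff /eqP <- : row_free M by apply: rank_leq_col.
rewrite -kermx_eq0; apply/eqP/row_matrixP => k; rewrite row0; set u := row k _.
have uM : u *m M = 0 by apply/sub_kermxP; apply: row_sub.
apply/rowP => i; rewrite [RHS]mxE; apply: (bi (u 0)).
under eq_bigr => j _ do rewrite fE scaler_sumr.
rewrite exchange_big big1 // => j _.
have -> : \sum_i u 0 i *: (f i j *: phi (tnth (in_tuple l) j)) =
    (u *m M) 0 j *: phi (tnth (in_tuple l) j).
  rewrite mxE scaler_suml; apply: eq_bigr => i' _.
  by rewrite [M _ _]mxE scalerA.
by rewrite uM mxE scale0r.
Qed.

End Dimension.

Section Variety.
Variables (K : fieldType) (V : lieAlgType K -> Prop).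
Local Notation x := (@relfree_gen K V).

Lemma multilinear_span n v : @multilinear K V n.+1 v ->
  Defs.span [set u | exists2 w, perm_eq w (iota 1 n) & u = ad_word x w (x n.+1)] v.
Proof.
have iS : iota 1 n.+1 = rcons (iota 1 n) n.+1.
  by rewrite -[in LHS](addn1 n) iotaD cats1.
apply: (@span_morph _ _ _ idfun) => // _ [M Mn ->] /=.
rewrite (@eval_mon_right_normed _ _ _ n.+1); last first.
  by rewrite (permP Mn) count_uniq_mem ?iota_uniq // iS mem_rcons mem_head.
apply: assoc_span => w /perm_trans/(_ Mn).
case/lastP: w => [/perm_size//|w i]; rewrite right_normed_rcons.
case: eqP => [-> |_ _]; last exact: span0.
rewrite iS -!cats1 perm_cat2r => wn.
by apply: span_sub; exists w.
Qed.

(** The variables of the multilinear identity are the positions of a word w0 with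
    nonzero coefficient in the leading component of f, coloured by the letters of
    w0.  The last position is the argument of the operators. *)
Lemma variety_ad_identity k f : is_variety V ->
  f != 0 -> has_degree k.+1 f -> satisfies V f ->
  exists2 beta : seq nat -> K, beta (iota 0 k) != 0 & ad_identity (relfree V) k beta.
Proof.
move=> varV f0 [g [gh gk ->]] Vf.
have /choice[P PE] i := span_eval_poly (gh i).
have [w0 w0P] : exists w, assoc_coef (P k.+1) w != 0.
  by apply: assoc_coef_exists; rewrite -(PE k.+1).2.
have sw0 : size w0 = k.+1 by apply: assoc_coef_size (PE k.+1).1 w0P.
pose Q := flatten [seq P i | i <- iota 0 k.+1].
have H (rho : nat -> relfree V) : eval_poly rho (Q ++ P k.+1) = 0.
  have [h hh hx] := @relfree_lift K (fun=> True) (relfree V) rho I.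
  have hE p : h (eval_poly (@relfree_gen K (fun=> True)) p) = eval_poly rho p.
    by rewrite lie_hom_eval //; congr eval_poly; apply/funext.
  rewrite -hE -[RHS](Vf _ (relfree_in_variety varV) h hh); congr h.
  rewrite eval_cat big_ord_recr -(PE k.+1).2; congr (_ + _).
  rewrite -(big_mkord xpredT g) /index_iota subn0 /Q.
  elim: (iota 0 k.+1) => [|i r IH] /=; first by rewrite /eval_poly !big_nil.
  by rewrite eval_cat big_cons IH -(PE i).2.
have Id (a : nat -> relfree V) : \sum_(s <- permutations (iota 0 k.+1))
    assoc_coef (P k.+1) (map (nth 0%N w0) s) *: right_normed a k s = 0.
  apply: (@multilinear_part _ _ _ _ a k.+1 (P k.+1) Q k) => //.
  - exact: iota_uniq.
  - exact: size_iota.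
  - by rewrite mem_iota ltnSn.
  - exact: (PE k.+1).1.
  - move=> p /flatten_mapP[i]; rewrite mem_iota add0n => ik /(PE i).1 ->.
    exact: ik.
exists (fun s => assoc_coef (P k.+1) (map (nth 0%N w0) (rcons s k))).
  suff -> : map (nth 0%N w0) (rcons (iota 0 k) k) = w0 by [].
  by rewrite -cats1 -(iotaD 0 k 1) addn1 -sw0 map_nth_iota0 // take_size.
exact: (ad_identity_of_right_normed Id).
Qed.

End Variety.

Theorem theorem4p5 (R : realType) (K : fieldType) (m : nat)
    (V : lieAlgType K -> Prop) :
  (2 <= m)%N ->
  is_variety V ->
  (exists f : free_lie K, [/\ f != 0, has_degree m f & satisfies V f]) ->
  coef_le (complexity R V) (r_tilde R m).
Proof.
case: m => [|[|d]] // _ varV [f [f0 fd Vf]] [|n]; first by rewrite r_tilde_coef0.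
have [beta b0 idV] := variety_ad_identity varV f0 fd Vf.
rewrite [leRHS]/(forests R d n) /complexity.
have [l [lP lsize]] := irreducible_words R d (iota_uniq 1 n) (size_iota 1 n).
have cl : (codim V n.+1 <= size l)%N.
  apply: (has_dim_le (phi := fun w => ad_word (@relfree_gen K V) w (relfree_gen V n.+1))
    (codimP V n.+1)) => v /multilinear_span.
  apply: (@span_morph _ _ _ idfun) => // _ [w wn ->] /=.
  apply: (@span_morph _ _ _ idfun) (ad_word_irreducible_span _ w _ idV b0) => //.
  move=> _ [u [uw nu] ->]; apply: span_sub; exists u => //; apply: lP nu.
  exact: perm_trans uw wn.
rewrite ler_pdivrMr ?ltr0n ?fact_gt0 //.
apply: le_trans (_ : _ <= (size l)%:R) _; first by rewrite ler_nat.
apply: le_trans lsize _; rewrite mulrC ler_wpM2l ?forests_ge0 //.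
by rewrite ler_nat factS leq_pmull.
Qed.
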